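(* Fix some $1\leq p<\infty$. Let $G=\mathbb{Z}\wr\mathbb{Z}$ and let $f:\mathbb{R}_+\to\mathbb{R}_+$ be an increasing function satisfying $$\int_1^{\infty}\left(\frac{f(t)}{t^{p/(2p-1)}}\right)^p\frac{dt}{t}<\infty.$$ Then there exists a $1$-cocycle $b\in Z^1(G,\lambda_{G,p})$ whose compression $\rho$ satisfies $\rho\succeq f$. In particular, $$B_p(\mathbb{Z}\wr\mathbb{Z})\geq \frac{p}{2p-1}.$$
   Context: $\mathbb{Z}\wr\mathbb{Z}=\mathbb{Z}\ltimes\mathbb{Z}^{(\mathbb{Z})}$, where $\mathbb{Z}$ acts on the direct sum $\mathbb{Z}^{(\mathbb{Z})}$ by shifts. For a finitely generated group $G$ let $S$ be a finite symmetric generating subset and $|g|_S=\inf\{n\in\mathbb{N}: g\in S^n\}$. For an isometric linear representation $\pi$ of $G$ on a Banach space $E$, $Z^1(G,\pi)$ is the set of maps $b:G\to E$ with $b(gh)=\pi(g)b(h)+b(g)$ for all $g,h\in G$. The compression of $b$ is $\rho(t)=\inf_{|g|_S\geq t}\|b(g)\|$. The left regular representation $\lambda_{G,p}$ on $\ell^p(G)$ is $\lambda_{G,p}(g)\varphi=\varphi(g^{-1}\cdot)$. An $L^p$-representation is a linear $G$-action on a Banach space of the form $L^p(X,m)$, $(X,m)$ a measure space. For nondecreasing nonzero functions $f,g:\mathbb{R}_+\to[0,\infty]$, $f\preceq g$ (equivalently $g\succeq f$) means that there exists $C>0$ such that $f(t)=O(g(Ct))$ as $t\to\infty$. $B_\pi(G)$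 is the supremum of all $\alpha$ such that there exists $b\in Z^1(G,\pi)$ whose compression satisfies $\rho(t)\succeq t^\alpha$; $B_p(G)$ is the supremum of $B_\pi(G)$ over all isometric $L^p$-representations $\pi$ of $G$. *)

(* Defs.v *)
(* Uses MathComp and MathComp-Analysis. *)
From HB Require Import structures.
From mathcomp Require Import all_boot all_order all_algebra finmap.
From mathcomp Require Import all_classical all_reals all_analysis.
From mathcomp Require Import measurable_realfun ess_sup_inf.
Set Implicit Arguments.
Unset Strict Implicit.
Unset Printing Implicit Defensive.
Import Order.TTheory GRing.Theory Num.Theory.
Import numFieldNormedType.Exports.
Local Open Scope classical_set_scope.
Local Open Scope ring_scope.

(* The Banach space L^p(X, mu) over R: LfunType mu p1 consists of genuine
   functions, so it is quotiented by almost-everywhere equality; the library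
   quotient LspaceType carries neither a module structure nor a norm. *)
Section Lp_quotient.
Context d (X : measurableType d) (R : realType).
Variables (mu : {measure set X -> \bar R}) (p : \bar R) (p1 : (1 <= p)%E).
Local Notation Lf := (LfunType mu p1).
Local Open Scope quotient_scope.

Definition Lfun_ae_eq (f g : Lf) : bool :=
  `[< (f : X -> R) = (g : X -> R) %[ae mu] >].

Lemma Lfun_ae_eqP (f g : Lf) :
  reflect ((f : X -> R) = (g : X -> R) %[ae mu]) (Lfun_ae_eq f g).
Proof. exact: asboolP. Qed.

Let Lfun_ae_eq_refl : reflexive Lfun_ae_eq.
Proof. by move=> f; apply/asboolP; exact: ae_eq_refl. Qed.

Let Lfun_ae_eq_sym : symmetric Lfun_ae_eq.
Proof.
by move=> f g; apply/idP/idP => /asboolP h; apply/asboolP; exact: ae_eq_sym.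
Qed.

Let Lfun_ae_eq_trans : transitive Lfun_ae_eq.
Proof.
by move=> f g h /asboolP gf /asboolP fh; apply/asboolP; exact: ae_eq_trans gf fh.
Qed.

Canonical Lfun_ae_eq_equiv :=
  EquivRel Lfun_ae_eq Lfun_ae_eq_refl Lfun_ae_eq_sym Lfun_ae_eq_trans.

Definition Lp : Type := {eq_quot Lfun_ae_eq}.
HB.instance Definition _ := Choice.on Lp.
HB.instance Definition _ := EqQuotient.on Lp.

Lemma Lp_piP (f g : Lf) :
  \pi_Lp f = \pi_Lp g <-> (f : X -> R) = (g : X -> R) %[ae mu].
Proof.
split=> [/eqP|fg]; first by rewrite eqmodE => /asboolP.
by apply/eqP; rewrite eqmodE; apply/asboolP.
Qed.

Lemma Lp_reprP (f : Lf) : (repr (\pi_Lp f) : X -> R) = (f : X -> R) %[ae mu].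
Proof. by apply/Lp_piP; rewrite reprK. Qed.

Lemma LfunD_apply (f g : Lf) x : (f + g) x = f x + g x.
Proof. by []. Qed.

Lemma LfunN_apply (f : Lf) x : (- f) x = - f x.
Proof. by []. Qed.

Lemma LfunZ_apply a (f : Lf) x : (a *: f) x = a * f x.
Proof. by []. Qed.

Lemma Lp_ind (P : Lp -> Prop) : (forall f, P (\pi_Lp f)) -> forall u, P u.
Proof. by move=> h u; rewrite -[u]reprK; exact: h. Qed.

Let zero : Lp := \pi_Lp 0.
Let opp (u : Lp) : Lp := \pi_Lp (- repr u).
Let add (u v : Lp) : Lp := \pi_Lp (repr u + repr v).
Let scale (a : R) (u : Lp) : Lp := \pi_Lp (a *: repr u).

Let pi_opp f : opp (\pi_Lp f) = \pi_Lp (- f).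
Proof.
apply/Lp_piP; have := Lp_reprP f.
by apply: filterS => x h xT; rewrite ?LfunN_apply ?LfunZ_apply h.
Qed.

Let pi_add f g : add (\pi_Lp f) (\pi_Lp g) = \pi_Lp (f + g).
Proof.
apply/Lp_piP; have := Lp_reprP g; have := Lp_reprP f.
by apply: filterS2 => x hf hg xT; rewrite !LfunD_apply hf// hg.
Qed.

Let pi_scale a f : scale a (\pi_Lp f) = \pi_Lp (a *: f).
Proof.
apply/Lp_piP; have := Lp_reprP f.
by apply: filterS => x h xT; rewrite ?LfunN_apply ?LfunZ_apply h.
Qed.

Let addA : associative add.
Proof.
by move=> u v w; elim/Lp_ind: u => f; elim/Lp_ind: v => g; elim/Lp_ind: w => h; rewrite !pi_add addrA.
Qed.

Let addC : commutative add.
Proof. by move=> u v; elim/Lp_ind: u => f; elim/Lp_ind: v => g; rewrite !pi_add addrC. Qed.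

Let add0 : left_id zero add.
Proof. by move=> u; elim/Lp_ind: u => f; rewrite pi_add add0r. Qed.

Let addN : left_inverse zero opp add.
Proof. by move=> u; elim/Lp_ind: u => f; rewrite pi_opp pi_add addNr. Qed.

HB.instance Definition _ := GRing.isZmodule.Build Lp addA addC add0 addN.

Let scaleA a b v : scale a (scale b v) = scale (a * b) v.
Proof. by elim/Lp_ind: v => f; rewrite !pi_scale scalerA. Qed.

Let scale1 : left_id 1 scale.
Proof. by move=> u; elim/Lp_ind: u => f; rewrite pi_scale scale1r. Qed.

Let scaleDr : right_distributive scale +%R.
Proof.
move=> a u v; elim/Lp_ind: u => f; elim/Lp_ind: v => g.
by rewrite [_ + _]pi_add !pi_scale [RHS]pi_add scalerDr.
Qed.

Let scaleDl v : {morph scale^~ v : a b / a + b}.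
Proof.
move=> a b; elim/Lp_ind: v => f.
by rewrite !pi_scale [RHS]pi_add scalerDl.
Qed.

HB.instance Definition _ :=
  GRing.Zmodule_isLmodule.Build R Lp scaleA scale1 scaleDr scaleDl.

Lemma Lp_piD (f g : Lf) : \pi_Lp (f + g) = \pi_Lp f + \pi_Lp g.
Proof. by rewrite [RHS]pi_add. Qed.

Lemma Lp_piZ a (f : Lf) : \pi_Lp (a *: f) = a *: \pi_Lp f.
Proof. by rewrite [RHS]pi_scale. Qed.

Lemma Lp_pi0 : \pi_Lp 0 = 0.
Proof. by []. Qed.

Lemma ae_eq_Lnorm (f g : Lf) : (f : X -> R) = (g : X -> R) %[ae mu] ->
  ('N[mu]_p[EFin \o f] = 'N[mu]_p[EFin \o g])%E.
Proof.
move=> fg.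
have fgE : \forall x \ae mu, (abse \o (EFin \o f)) x = (abse \o (EFin \o g)) x.
  by apply: filterS fg => x /(_ Logic.I) /= ->.
rewrite unlock; case: p p1 f g fg fgE => [r r1 f g fg fgE|p1' f g fg fgE|//]; last first.
  by case: ifPn => // _; exact: eq_ess_sup.
have mpow (h : LfunType mu r1) : measurable_fun setT
    ((fun x => (`|(h x)%:E| `^ r)%E) : X -> \bar R).
  apply: (measurableT_comp (measurable_poweR _)).
  by apply: measurableT_comp => //; exact: measurableT_comp.
congr (_ `^ _)%E; apply: ae_eq_integral => //.
- exact: mpow.
- exact: mpow.
- by apply: filterS fg => x /(_ Logic.I) fgx _ /=; rewrite fgx.
Qed.

Definition Lp_norm (u : Lp) : R := fine ('N[mu]_p[EFin \o repr u])%E.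

Lemma Lp_norm_pi (f : Lf) : Lp_norm (\pi_Lp f) = fine ('N[mu]_p[EFin \o f])%E.
Proof. by rewrite /Lp_norm (ae_eq_Lnorm (Lp_reprP f)). Qed.

Let Lp_normD u v : Lp_norm (u + v) <= Lp_norm u + Lp_norm v.
Proof.
elim/Lp_ind: u => f; elim/Lp_ind: v => g.
by rewrite -Lp_piD !Lp_norm_pi; exact: ler_LnormD.
Qed.

Let Lp_normZ a u : Lp_norm (a *: u) = `|a| * Lp_norm u.
Proof.
elim/Lp_ind: u => f; rewrite -Lp_piZ !Lp_norm_pi.
by apply: EFin_inj; rewrite EFinM !finite_norm_fine -LnormZ.
Qed.

Let Lp_norm_eq0 u : Lp_norm u = 0 -> u = 0.
Proof.
elim/Lp_ind: u => f; rewrite Lp_norm_pi => /fine_Lnormr_eq0 f0.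
exact/Lp_piP.
Qed.

HB.instance Definition _ :=
  Lmodule_isNormed.Build R Lp Lp_normD Lp_normZ Lp_norm_eq0.

Lemma Lp_normE (f : Lf) : `|\pi_Lp f| = fine ('N[mu]_p[EFin \o f])%E.
Proof. exact: Lp_norm_pi. Qed.

End Lp_quotient.

Section representations.
Local Open Scope group_scope.
Variables (R : realType) (G : groupType) (E : normedModType R).

Record isom_repr := IsomRepr {
  repr_fun :> G -> {linear E -> E};
  repr_one : forall v, repr_fun 1 v = v;
  repr_mul : forall g h v, repr_fun (g * h) v = repr_fun g (repr_fun h v);
  repr_isometric : forall g v, `|repr_fun g v| = `|v| }.

Definition cocycle (pi : isom_repr) : set (G -> E) :=
  [set b | forall g h, b (g * h) = (pi g (b h) + b g)%R].

End representations.

Section word_length.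
Local Open Scope group_scope.
Variables (R : realType) (G : groupType).
Implicit Types (S : set G) (g : G).

(* S^n as the set of products of exactly n elements of S. *)
Fixpoint set_exp S n : set G :=
  if n is n'.+1 then [set x * y | x in S & y in set_exp S n'] else [set 1].

Definition symmetric_set S := forall s, S s -> S s^-1.

Definition subgroup (H : set G) :=
  [/\ H 1, forall x y, H x -> H y -> H (x * y) & forall x, H x -> H x^-1].

Definition generating S :=
  forall H : set G, subgroup H -> S `<=` H -> H = setT.

Definition word_length S g : \bar R :=
  ereal_inf [set n%:R%:E | n in [set n | set_exp S n g]].

Definition compression (E : normedModType R) S (b : G -> E) (t : R) : \bar R :=
  ereal_inf [set `|b g|%:E | g in [set g | (t%:E <= word_length S g)%E]].

End word_length.

(* G with the sigma-algebra of all its subsets, so that l^p(G) is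
   L^p(G, counting). *)
Section discrete_group.
Variable G : groupType.

Definition discrete_group : Type := G.
HB.instance Definition _ := Group.on discrete_group.
HB.instance Definition _ := isPointed.Build discrete_group 1%g.
HB.instance Definition _ := @isMeasurable.Build default_measure_display
  discrete_group (@discrete_measurable discrete_group)
  (@discrete_measurable0 discrete_group) (@discrete_measurableC discrete_group)
  (@discrete_measurableU discrete_group).

End discrete_group.

Section regular_representation.
Local Open Scope quotient_scope.
Variables (R : realType) (G : groupType) (p : R) (p1 : (1 <= p%:E)%E).
Local Notation mu := (counting : {measure set (discrete_group G) -> \bar R}).

Definition ellp := Lp mu p1.
HB.instance Definition _ := NormedModule.on ellp.
Local Notation Lf := (LfunType mu p1).

Lemma ae_counting (P : set (discrete_group G)) :
  (\forall x \ae mu, P x) <-> forall x, P x.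
Proof.
split=> [[A [_ A0 PA]] x|h]; last exact/nearW.
apply: contrapT => Px; have Ax : A x by apply: PA.
move: A0; rewrite /= /counting; case: ifPn => // /asboolP fA.
move=> /eqP; rewrite eqe pnatr_eq0 cardfs_eq0 => /eqP/fset_set_set0 A0.
by move: Ax; rewrite A0.
Qed.

Lemma counting_preimage (h k : discrete_group G -> discrete_group G) (A : set (discrete_group G)) :
  cancel h k -> cancel k h -> counting (h @^-1` A) = counting A :> \bar R.
Proof.
move=> hk kh.
have -> : h @^-1` A = k @` A.
  apply/seteqP; split=> [x /= Ax|x [y Ay <-]] /=; last by rewrite kh.
  by exists (h x).
have kI : {in A &, injective k} by move=> x y _ _; exact: can_inj kh x y.
rewrite /counting; have [fA|nfA] := pselect (finite_set A).
  rewrite !asboolT//; last exact: finite_image.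
  congr (_%:R%:E); rewrite fset_set_image// card_in_imfset// => x y.
  by rewrite !in_fset_set//; exact: kI.
rewrite !asboolF// => fkA; apply: nfA.
have -> : A = h @` (k @` A).
  rewrite image_comp -[LHS]image_id.
  by apply/seteqP; split=> _ [y Ay <-]; exists y => //=; rewrite kh.
exact: finite_image.
Qed.

Lemma translate_Lnorm (g : G) (f : discrete_group G -> R) :
  ('N[mu]_(p%:E)[EFin \o (fun x : discrete_group G => f (g^-1 * x)%g)] =
   'N[mu]_(p%:E)[EFin \o f])%E.
Proof.
pose h := (fun x => (g^-1 * x)%g) : discrete_group G -> discrete_group G.
have hk : cancel h (fun x => (g * x)%g) by move=> x; rewrite /h mulVKg.
have kh : cancel (fun x => (g * x)%g) h by move=> x; rewrite /h mulKg.
rewrite unlock; congr (_ `^ _)%E.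
have mh : measurable_fun setT h by [].
rewrite -[X in integral mu X _](preimage_setT h).
rewrite -(@ge0_integral_pushforward _ _ _ _ _ _ mh mu setT
  (fun x => (`|(f x)%:E| `^ p)%E))//; last by move=> y _; exact: poweR_ge0.
apply: eq_measure_integral => A _ _; exact: counting_preimage hk kh.
Qed.

Lemma translate_Lfun (g : G) (f : Lf) :
  (fun x : discrete_group G => f (g^-1 * x)%g) \in Lfun mu p%:E.
Proof.
apply/andP; split; first by rewrite inE.
by rewrite inE/= /finite_norm translate_Lnorm; exact: Lfunction_finite.
Qed.

Definition translate (g : G) (f : Lf) : Lf := Lfun_Sub p1 (translate_Lfun g f).

(* lreg_fun g phi = phi(g^-1 .); taking a representative is harmless, since
   almost-everywhere equality for the counting measure is equality. *)
Definition lreg_fun (g : G) (phi : ellp) : ellp :=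
  \pi_(Lp mu p1) (translate g (repr phi)).

Lemma lreg_fun_pi g (f : Lf) :
  lreg_fun g (\pi_(Lp mu p1) f) = \pi_(Lp mu p1) (translate g f).
Proof.
apply/Lp_piP/ae_counting => x _ /=.
by have /ae_counting/(_ _ Logic.I) := Lp_reprP f; exact.
Qed.

Fact lreg_is_linear g : linear (lreg_fun g).
Proof.
move=> a u v; elim/Lp_ind: u => e; elim/Lp_ind: v => f.
by rewrite -Lp_piZ -Lp_piD !lreg_fun_pi -Lp_piZ -Lp_piD; apply/Lp_piP/ae_counting.
Qed.

HB.instance Definition _ g :=
  GRing.isLinear.Build R ellp ellp *:%R (lreg_fun g) (lreg_is_linear g).

Let lreg_one v : lreg_fun 1%g v = v.
Proof.
elim/Lp_ind: v => f; rewrite lreg_fun_pi; apply/Lp_piP/ae_counting => x _ /=.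
by rewrite invg1 mul1g.
Qed.

Let lreg_mul g h v : lreg_fun (g * h)%g v = lreg_fun g (lreg_fun h v).
Proof.
elim/Lp_ind: v => f; rewrite !lreg_fun_pi; apply/Lp_piP/ae_counting => x _ /=.
by rewrite invgM mulgA.
Qed.

Let lreg_isometric g v : `|lreg_fun g v| = `|v|.
Proof.
elim/Lp_ind: v => f; rewrite lreg_fun_pi !Lp_normE.
by congr fine; exact: translate_Lnorm.
Qed.

Definition lreg : isom_repr G ellp :=
  @IsomRepr R G ellp (fun g => lreg_fun g : {linear ellp -> ellp})
    lreg_one lreg_mul lreg_isometric.

End regular_representation.

Section compression_exponents.
Variables (R : realType) (G : groupType) (S : set G).

(* f(t) = O(g(C t)) as t tends to +oo, for functions with values in [0, +oo];
   only the values on the nonnegative half-line matter. *)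
Definition asymp_le (f g : R -> \bar R) :=
  exists2 C : R, 0 < C &
  exists2 K : R, 0 < K & \forall t \near +oo, (f t <= K%:E * g (C * t)%R)%E.

(* t^a is compared only when it is nondecreasing, hence 0 <= a. *)
Definition B_repr (E : normedModType R) (pi : isom_repr G E) : \bar R :=
  ereal_sup [set a%:E | a in [set a : R | 0 <= a /\
    exists2 b, cocycle pi b &
      asymp_le (fun t => (t `^ a)%:E) (compression S b)]].

Definition B_Lp (p : \bar R) (p1 : (1 <= p)%E) : \bar R :=
  ereal_sup [set x | exists d (X : measurableType d)
    (m : {measure set X -> \bar R}) (pi : isom_repr G (Lp m p1)),
    x = B_repr pi].

End compression_exponents.

Definition lamps := {fsfun int -> int with 0}.
HB.instance Definition _ := Choice.on lamps.

Section lamps_zmodule.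
Implicit Types (u v w : lamps).

Let opp u : lamps := [fsfun x in finsupp u => - u x].
Let add u v : lamps := [fsfun x in (finsupp u `|` finsupp v)%fset => u x + v x].

Let oppE u x : opp u x = - u x.
Proof. by rewrite fsfunE mem_finsupp; case: eqP => //= ->; rewrite oppr0. Qed.

Let addE u v x : add u v x = u x + v x.
Proof.
by rewrite fsfunE inE !mem_finsupp; case: eqP => //= ->; case: eqP => //= ->;
  rewrite addr0.
Qed.

Let addA : associative add.
Proof. by move=> u v w; apply/fsfunP => x; rewrite !addE addrA. Qed.

Let addC : commutative add.
Proof. by move=> u v; apply/fsfunP => x; rewrite !addE addrC. Qed.

Let add0 : left_id ([fsfun] : lamps) add.
Proof. by move=> u; apply/fsfunP => x; rewrite addE fsfunE add0r. Qed.

Let addN : left_inverse ([fsfun] : lamps) opp add.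
Proof. by move=> u; apply/fsfunP => x; rewrite addE oppE fsfunE addNr. Qed.

HB.instance Definition _ := GRing.isZmodule.Build lamps addA addC add0 addN.

Lemma lampsD u v x : (u + v) x = u x + v x.
Proof. exact: addE. Qed.

Lemma lampsN u x : (- u) x = - u x.
Proof. exact: oppE. Qed.

Lemma lamps0 x : (0 : lamps) x = 0.
Proof. by rewrite [LHS]fsfunE. Qed.

Definition lamp_shift (n : int) u : lamps :=
  [fsfun x in [fset (y + n)%R | y in finsupp u]%fset => u (x - n)].

Lemma lamp_shiftE n u x : lamp_shift n u x = u (x - n).
Proof.
rewrite fsfunE; case: imfsetP => //= h; apply/esym/eqP.
rewrite -[_ == _]negbK -mem_finsupp; apply/negP => ux; apply: h.
by exists (x - n) => //; rewrite subrK.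
Qed.

End lamps_zmodule.

(* The pair (n, u) is the product u n in Z |x Z^(Z), so that
   (m, u) (n, v) = (m + n, u + m.v). *)
Definition ZwrZ : Type := (int * lamps)%type.
HB.instance Definition _ := Choice.on ZwrZ.

Section ZwrZ_group.

Let one : ZwrZ := (0, 0).
Let inv (g : ZwrZ) : ZwrZ := (- g.1, - lamp_shift (- g.1) g.2).
Let mul (g h : ZwrZ) : ZwrZ := (g.1 + h.1, g.2 + lamp_shift g.1 h.2).

Let mulA : associative mul.
Proof.
move=> [m u] [n v] [k w]; congr pair; rewrite /= ?addrA//.
by apply/fsfunP => x; rewrite !(lampsD, lamp_shiftE) addrA opprD addrA.
Qed.

Let mul1 : left_id one mul.
Proof.
move=> [m u]; congr pair; rewrite /= ?add0r//.
by apply/fsfunP => x; rewrite lamp_shiftE subr0.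
Qed.

Let mulr1 : right_id one mul.
Proof.
move=> [m u]; congr pair; rewrite /= ?addr0//.
by apply/fsfunP => x; rewrite lampsD lamp_shiftE lamps0 addr0.
Qed.

Let mulV : left_inverse one inv mul.
Proof.
by move=> [m u]; congr pair; rewrite /= addNr.
Qed.

Let mulrV : right_inverse one inv mul.
Proof.
move=> [m u]; congr pair; rewrite /= ?addrN//; apply/fsfunP => x.
by rewrite lampsD lamp_shiftE lampsN lamp_shiftE lamps0 opprK subrK addrN.
Qed.

HB.instance Definition _ := isGroup.Build ZwrZ mulA mul1 mulr1 mulV mulrV.

Lemma ZwrZ_mulE (g h : ZwrZ) :
  (g * h)%g = (g.1 + h.1, g.2 + lamp_shift g.1 h.2) :> ZwrZ.
Proof. by []. Qed.

End ZwrZ_group.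

(* Main.v *)
(* Put q = p/(2p-1). At scale T = 2^k take a box of configurations: the cursor
   and the support of the lamps lie in an interval of N ~ T^q sites, and the
   lamp values in {0, ..., N-1}. On the box put the product, over the cursor and
   over all lamps, of one profile chi on {0, ..., N-1} with unit p-norm and with
   gradient of p-norm O(T^(-q)). An element of length ~ T either moves the cursor
   or some lamp out of the interval, or shifts the lamps by v_i with
   sum_i |v_i| ~ T; a random configuration then stays in the box with probability
   prod_i (1 - loss(v_i)). The profile is a tent raised near both ends to a
   plateau of height ~ T^(-(p-1)/(p(2p-1))), reached by a ramp of width ~ T^(1-q):
   this leaves the gradient of order T^(-q) but keeps sum_i loss(v_i) bounded
   below. So every element of length ~ T moves the product function by a definite
   proportion of its norm, although each generator moves it only by O(T^(-q)).
   Weight scale k by f(2^k) and place the boxes at sites so sparse that an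
   element of length ~ 2^k cannot carry box k to another box. The sum Phi of these
   functions gives the cocycle g |-> (x |-> Phi(x^-1 g) - Phi(x^-1)), which is
   p-summable because sum_k (f(2^k)/2^(kq))^p converges. *)
Require Import Defs.
From HB Require Import structures.
From mathcomp Require Import all_boot all_order all_algebra finmap.
From mathcomp Require Import all_classical all_reals all_analysis.
From mathcomp Require Import measurable_realfun zify ring lra.
Set Implicit Arguments.
Unset Strict Implicit.
Unset Printing Implicit Defensive.
Import Order.TTheory GRing.Theory Num.Theory.
Import numFieldNormedType.Exports.
Local Open Scope classical_set_scope.
Local Open Scope ring_scope.

(** * Integrals for the counting measure *)

Section counting_integral.
Context {R : realType} {G : groupType}.
Local Notation mu := (counting : {measure set (discrete_group G) -> \bar R}).
Implicit Types D : discrete_group G -> R.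

(** Comparison function for the two bounds below: every point has counting measure 1. *)
Lemma integral_sum_indic (I : finType) (pt : I -> discrete_group G) D :
  (forall y, 0 <= D y) ->
  (\int[mu]_y (\sum_(i : I) D (pt i) * \1_[set pt i] y)%:E =
   (\sum_(i : I) D (pt i))%:E)%E.
Proof.
move=> D0; under eq_integral do rewrite -sumEFin.
rewrite ge0_integral_sum//; last first.
  by move=> i y _; rewrite lee_fin mulr_ge0.
rewrite -sumEFin; apply: eq_bigr => i _.
under eq_integral do rewrite EFinM.
rewrite ge0_integralZl//; last by rewrite lee_fin.
rewrite integral_indic// setIT/= /counting asboolT//=.
by rewrite fset_set1 cardfs1 mule1.
Qed.

(** Injectivity ensures that at most one of the point masses is present at each y, so their sum
    stays below [D]. *)
Lemma counting_integral_ge (I : finType) (pt : I -> discrete_group G) D :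
  (forall y, 0 <= D y) -> injective pt ->
  ((\sum_(i : I) D (pt i))%:E <= \int[mu]_y (D y)%:E)%E.
Proof.
move=> D0 pt_inj; rewrite -integral_sum_indic//; apply: ge0_le_integral => //.
  by move=> y _; rewrite lee_fin sumr_ge0// => i _; rewrite mulr_ge0.
move=> y _; rewrite lee_fin; have [[i iy]|ny] := pselect (exists i, pt i = y).
  rewrite (bigD1 i)//= iy indicE mem_set// mulr1 big1 ?addr0// => j ji.
  rewrite indicE memNset ?mulr0//= => yj.
  by move: ji; rewrite (pt_inj j i) ?eqxx// iy.
rewrite big1// => i _; rewrite indicE memNset ?mulr0//= => yi.
by apply: ny; exists i.
Qed.

Lemma counting_integral_le (I : finType) (pt : I -> discrete_group G) D :
  (forall y, 0 <= D y) -> (forall y, D y != 0 -> exists i, pt i = y) ->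
  (\int[mu]_y (D y)%:E <= (\sum_(i : I) D (pt i))%:E)%E.
Proof.
move=> D0 Dpt; rewrite -integral_sum_indic//; apply: ge0_le_integral => //.
  by move=> y _; rewrite lee_fin.
have S0 y i : 0 <= D (pt i) * \1_[set pt i] y by rewrite mulr_ge0.
move=> y _; rewrite lee_fin; have [->|/Dpt[i iy]] := eqVneq (D y) 0.
  exact: sumr_ge0.
by rewrite (bigD1 i)//= iy indicE mem_set// mulr1 lerDl sumr_ge0.
Qed.

Context {p : R} (p1 : (1 <= p%:E)%E).

Lemma Lfun_counting (f : discrete_group G -> R) :
  (\int[mu]_y (`|f y| `^ p)%:E < +oo)%E -> f \in Lfun mu p%:E.
Proof.
move=> fp; apply/andP; split; first by rewrite inE.
by rewrite inE/= /finite_norm unlock poweR_lty.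
Qed.

Local Open Scope quotient_scope.

Lemma ellp_norm_powR (f : LfunType mu p1) :
  ((`|\pi_(Lp mu p1) f| `^ p)%:E = \int[mu]_y (`|f y| `^ p)%:E)%E.
Proof.
have p0 : p != 0 by rewrite gt_eqF// (lt_le_trans ltr01)// -lee_fin.
rewrite Lp_normE -poweR_EFin finite_norm_fine powR_Lnorm//.
Qed.

End counting_integral.

(** * The one-dimensional profile *)

Lemma powRD_gt0 {R : realType} (a r s : R) : 0 < a -> a `^ (r + s) = a `^ r * a `^ s.
Proof. by move=> a0; rewrite powRD// [a == 0]gt_eqF ?implybT. Qed.

Lemma inv_powR {R : realType} (a b : R) : 0 < a -> a^-1 `^ b = (a `^ b)^-1.
Proof. by move=> a0; rewrite -powR_inv1 ?ltW// powRAC powR_inv1 ?powR_ge0. Qed.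

Section profile.
Context {R : realType}.
Variables (p : R) (W r : nat).
Hypotheses (p1 : 1 <= p) (r0 : (0 < r)%N) (rW : (r <= W)%N).
Local Notation N := (4 * W)%N.

Lemma sum_nat_interval n a b :
  (\sum_(i < n) (a <= i < b) = minn n b - a)%N.
Proof. by elim: n => [|n IH]; rewrite ?big_ord0 ?big_ord_recr/= ?IH; lia. Qed.

Lemma sum_nat_lt n b : (\sum_(i < n) (i < b) = minn n b)%N.
Proof. by rewrite -[RHS]subn0 -sum_nat_interval. Qed.

Lemma dist_max (x y x' y' e : R) :
  `|x - x'| <= e -> `|y - y'| <= e -> `|Num.max x y - Num.max x' y'| <= e.
Proof.
rewrite !ler_norml => /andP[? ?] /andP[? ?].
by case: (leP x y) => ?; case: (leP x' y') => ?; lra.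
Qed.

Lemma dist_maxr (z x y : R) : `|Num.max z x - Num.max z y| <= `|x - y|.
Proof. by apply: dist_max; rewrite ?subrr ?normr0. Qed.

Lemma dist_minr (z x y : R) : `|Num.min z x - Num.min z y| <= `|x - y|.
Proof.
have : - `|x - y| <= x - y <= `|x - y| by rewrite -ler_norml.
rewrite ler_norml => /andP[? ?].
by case: (leP z x) => ?; case: (leP z y) => ?; apply/andP; split; lra.
Qed.

(** Height of the plateau near the edges, chosen so that the steep ramp costs as much gradient in
    p-th powers as the broad one; see [steep]. *)
Let h : R := (r%:R / W%:R) `^ (1 - p^-1).

Let W0 : 0 < W%:R :> R. Proof. by rewrite ltr0n; lia. Qed.
Let rR0 : 0 < r%:R :> R. Proof. by rewrite ltr0n; lia. Qed.
Let p0 : 0 < p. Proof. exact: lt_le_trans ltr01 p1. Qed.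
Let rW1 : r%:R / W%:R <= 1 :> R.
Proof. by rewrite ler_pdivrMr// mul1r ler_nat. Qed.
Let rWgt0 : 0 < r%:R / W%:R :> R. Proof. exact: divr_gt0. Qed.

Let one_powR (a : R) : 1 `^ a = 1. Proof. by rewrite powR1. Qed.

Let h0 : 0 < h. Proof. exact: powR_gt0. Qed.

Let pV1 : p^-1 <= 1. Proof. by rewrite invf_le1. Qed.

Let h1 : h <= 1.
Proof.
rewrite /h -[leRHS](one_powR (1 - p^-1)); apply: ge0_ler_powR; rewrite ?nnegrE//.
by rewrite subr_ge0.
Qed.

Let hp : h `^ p = (r%:R / W%:R) `^ (p - 1).
Proof. by rewrite /h -powRrM mulrBl mul1r mulVf// gt_eqF. Qed.

(** Inside {0, ..., N-1} this is the distance to the complement; outside it is at most 0. *)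
Definition depth (x : int) : R := (Num.min (x + 1) (N%:Z - x))%:~R.

(* The broad ramp, of slope 1/W, carries the mass; the steep ramp near the
   edges, of slope h/r, raises the mass lost under small translations at no
   cost for the p-norm of the gradient. *)
Definition taper (x : int) : R :=
  Num.max 0 (Num.max (Num.min h (h / r%:R * depth x))
                     (Num.min 1 (W%:R^-1 * depth x))).

Lemma taper_ge0 x : 0 <= taper x.
Proof. by rewrite le_max lexx. Qed.

Lemma taper_le1 x : taper x <= 1.
Proof. by rewrite !ge_max ler01 !ge_min h1 lexx. Qed.

Lemma taper_neq0 x : taper x != 0 -> (0 <= x < N%:Z)%R.
Proof.
apply: contraNT => xN; have d0 : depth x <= 0 by rewrite lerz0; clear -xN; lia.
have a0 : h / r%:R * depth x <= 0 by apply: mulr_ge0_le0 => //; rewrite divr_ge0// ltW.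
have b0 : W%:R^-1 * depth x <= 0 by apply: mulr_ge0_le0 => //; rewrite invr_ge0 ltW.
by rewrite /taper max_l// ge_max !ge_min a0 b0 !orbT.
Qed.

Let depth_ge (n : nat) (x : int) : (n%:Z <= x + 1)%R -> (x + n%:Z <= N%:Z)%R ->
  n%:R <= depth x.
Proof. by move=> nx xn; rewrite -[leLHS]/((n%:Z)%:~R) ler_int; clear -nx xn; lia. Qed.

Let steep_max (x : int) : (r%:Z <= x + 1)%R -> (x + r%:Z <= N%:Z)%R ->
  Num.min h (h / r%:R * depth x) = h.
Proof.
move=> rx xr; apply: min_l; rewrite -mulrA ler_peMr//; first exact: ltW.
by rewrite mulrC ler_pdivlMr// mul1r depth_ge.
Qed.

Lemma taper_plateau (x : int) : (W%:Z <= x + 1)%R -> (x <= 3 * W%:Z)%R -> taper x = 1.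
Proof.
move=> Wx xW; have E : Num.min 1 (W%:R^-1 * depth x) = 1.
  by apply: min_l; rewrite mulrC ler_pdivlMr// mul1r depth_ge//; clear -r0 rW Wx xW; lia.
by rewrite /taper E !max_r// ge_min h1.
Qed.

Lemma taper_edge (x : int) : (r%:Z <= x + 1)%R -> (x + r%:Z <= N%:Z)%R -> h <= taper x.
Proof. by move=> rx xr; rewrite /taper steep_max// !le_max lexx orbT. Qed.

Let depth_lip x : `|depth x - depth (x - 1)| <= 1.
Proof. by rewrite -intrB -intr_norm -[leRHS]/(1%:~R) ler_int; clear; lia. Qed.

Let slope_lip (a : R) x : 0 <= a -> `|a * depth x - a * depth (x - 1)| <= a.
Proof. by move=> a0; rewrite -mulrBr normrM ger0_norm// ler_piMr. Qed.

Lemma taper_lip (x : int) : `|taper x - taper (x - 1)| <= Num.max (h / r%:R) W%:R^-1.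
Proof.
have a0 : 0 <= h / r%:R by rewrite divr_ge0// ltW.
have b0 : 0 <= W%:R^-1 :> R by rewrite invr_ge0 ltW.
apply: le_trans (dist_maxr _ _ _) _.
apply: dist_max; apply: le_trans (dist_minr _ _ _) _; rewrite le_max.
- by rewrite slope_lip.
- by rewrite slope_lip// orbT.
Qed.

(** Both x and x - 1 have depth at least r, so the steep term is constantly [h] there and only the
    slope 1/W remains. *)
Lemma taper_lip_inner (x : int) : (r%:Z <= x)%R -> (x + r%:Z <= N%:Z)%R ->
  `|taper x - taper (x - 1)| <= W%:R^-1.
Proof.
move=> rx xr; have b0 : 0 <= W%:R^-1 :> R by rewrite invr_ge0 ltW.
rewrite /taper !steep_max; [|clear -rx xr; lia..].
apply: le_trans (dist_maxr _ _ _) _.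
apply: le_trans (dist_maxr _ _ _) _.
apply: le_trans (dist_minr _ _ _) _.
exact: slope_lip.
Qed.

(** In p-th powers, r steps of size h/r cost h^p r^(1-p); the choice of [h] makes this W^(1-p), the
    cost of W steps of size 1/W. *)
Let steep : (h / r%:R) `^ p * r%:R = W%:R `^ (1 - p).
Proof.
have -> : 1 - p = - (p - 1) by ring.
have rp : r%:R `^ p = r%:R `^ (p - 1) * r%:R :> R.
  rewrite -[X in _ = _ * X]powRr1; last exact: ltW.
  by rewrite -powRD_gt0// subrK.
rewrite powRM ?invr_ge0; [|exact: ltW..]; rewrite hp inv_powR// rp.
rewrite powRM ?invr_ge0; [|exact: ltW..]; rewrite inv_powR// powRN.
by field; rewrite !gt_eqF// powR_gt0.
Qed.

(** Every increment is charged the broad slope, and those near an end the steep slope as well: 4W +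
    2 <= 6W broad charges and 2r + 1 <= 3r steep ones, whence 9 = 6 + 3. The N + 2 indices match the
    enlarged configurations met under a generator. *)
Lemma taper_gradient :
  \sum_(i < N + 2) `|taper i%:Z - taper (i%:Z - 1)| `^ p <= 9 * W%:R `^ (1 - p).
Proof.
pose e (i : nat) : R := (i < r)%N%:R + (N - r < i < N + 2)%N%:R.
have wp : W%:R^-1 `^ p * W%:R = W%:R `^ (1 - p).
  rewrite -powR_inv1; last exact: ltW.
  rewrite -powRrM mulN1r -{2}[W%:R]powRr1; last exact: ltW.
  by rewrite -powRD_gt0// addrC.
have step (i : nat) : (i < N + 2)%N -> `|taper i%:Z - taper (i%:Z - 1)| `^ p <=
    W%:R^-1 `^ p + (h / r%:R) `^ p * e i.
  move=> iN; have [/andP[ri ir]|ei] := boolP ((r <= i) && (i + r <= N))%N.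
    apply: (@le_trans _ _ (W%:R^-1 `^ p)).
      apply: ge0_ler_powR; rewrite ?nnegrE ?invr_ge0//; try exact: ltW.
      by apply: taper_lip_inner; clear -ri ir; lia.
    by rewrite lerDl mulr_ge0 ?powR_ge0// addr_ge0.
  have e1 : 1 <= e i.
    have [ir|ir] := boolP (i < r)%N; first by rewrite /e ir lerDl.
    have Ni : (N - r < i < N + 2)%N by clear -iN ei ir; lia.
    by rewrite /e Ni lerDr.
  apply: (@le_trans _ _ (W%:R^-1 `^ p + (h / r%:R) `^ p)); last first.
    by rewrite lerD2l ler_peMr// powR_ge0.
  apply: (@le_trans _ _ (Num.max (h / r%:R) W%:R^-1 `^ p)).
    apply: ge0_ler_powR; rewrite ?nnegrE//; first exact: ltW.
      by rewrite le_max invr_ge0 (ltW W0) orbT.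
    exact: taper_lip.
  by case: (leP (h / r%:R)) => _; rewrite (lerDl, lerDr) powR_ge0.
apply: (@le_trans _ _ (\sum_(i < N + 2) (W%:R^-1 `^ p + (h / r%:R) `^ p * e i))).
  by apply: ler_sum => i _; exact: step.
rewrite big_split/= sumr_const card_ord -mulr_sumr big_split/=.
rewrite -!natr_sum !(sum_nat_interval, sum_nat_lt).
have -> : 9 * W%:R `^ (1 - p) = W%:R^-1 `^ p * (6 * W%:R) + (h / r%:R) `^ p * (3 * r%:R).
  rewrite [_ * (6 * _)]mulrCA [_ * (3 * _)]mulrCA steep wp; ring.
rewrite -[_ *+ (N + 2)]mulr_natr -natrD.
by apply: lerD; apply: ler_wpM2l; rewrite ?powR_ge0// -natrM ler_nat; clear -r0 rW; lia.
Qed.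

Lemma taper_mass_ge : (2 * W)%:R <= \sum_(i < N) taper i%:Z `^ p.
Proof.
apply: (@le_trans _ _ (\sum_(i < N) (W <= i < 3 * W)%N%:R)).
  by rewrite -natr_sum sum_nat_interval ler_nat; clear -r0 rW; lia.
apply: ler_sum => i _; case: (boolP (W <= i < 3 * W)%N) => [/andP[Wi iW]|_]; last exact: powR_ge0.
by rewrite taper_plateau ?powR1//; clear -Wi iW; lia.
Qed.

Lemma taper_mass_le : \sum_(i < N) taper i%:Z `^ p <= N%:R.
Proof.
rewrite -[leRHS]mul1r -[N in leRHS]card_ord mulr_natr -sumr_const.
apply: ler_sum => i _; rewrite -[leRHS](one_powR p).
by apply: ge0_ler_powR; rewrite ?nnegrE ?taper_ge0 ?taper_le1// ltW.
Qed.

(** A shift by v ejects the |v| sites nearest one end. At most 2r sites lie on the steep ramps; each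
    other ejected site has height at least [h], and h^p = (r/W)^(p-1). *)
Lemma taper_tail (v : int) : (`|v| <= N%:Z)%R ->
  (`|v|%:~R - 2 * r%:R) * (r%:R / W%:R) `^ (p - 1) <=
  \sum_(i < N | ~~ (0 <= i%:Z + v < N%:Z)%R) taper i%:Z `^ p.
Proof.
move=> vN; rewrite -hp big_mkcond/=.
(* Indicator of the ejected sites: the last |v| for v >= 0, the first |v| otherwise. *)
pose out (i : nat) : R := (if (0 <= v)%R then (N - `|v| <= i < N)%N else (i < `|v|)%N)%:R.
apply: (@le_trans _ _
  (\sum_(i < N) (out i - ((i < r)%N%:R + (N - r <= i < N)%N%:R)) * h `^ p)).
  rewrite -mulr_suml ler_wpM2r ?powR_ge0// sumrB big_split/= -!natr_sum.
  rewrite !(sum_nat_interval, sum_nat_lt); apply: lerB; last first.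
    by rewrite -natrD -natrM ler_nat; clear -r0 rW; lia.
  rewrite /out; case: (boolP (0 <= v)%R) => v0.
    rewrite sum_nat_interval.
    by rewrite -[leRHS]/((_ %:Z)%:~R) ler_int; clear -vN v0; lia.
  rewrite sum_nat_lt.
  by rewrite -[leRHS]/((_ %:Z)%:~R) ler_int; clear -vN v0; lia.
apply: ler_sum => i _; have iN := ltn_ord i.
have -> : out i = (~~ (0 <= i%:Z + v < N%:Z)%R)%:R.
  by rewrite /out; congr (_%:R); clear -iN vN; case: ifP => v0; lia.
case: (boolP (~~ _)) => _; last first.
  by rewrite sub0r mulNr oppr_le0 mulr_ge0 ?powR_ge0// addr_ge0.
have [ir|/negP ir] := boolP ((r <= i.+1) && (i + r <= N))%N.
  apply: (@le_trans _ _ (h `^ p)).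
    by rewrite ler_piMl ?powR_ge0// gerBl addr_ge0.
  apply: ge0_ler_powR; rewrite ?nnegrE ?taper_ge0//; try exact: ltW.
  by apply: taper_edge; clear -ir; lia.
apply: le_trans (powR_ge0 _ _); apply: mulr_le0_ge0 (powR_ge0 _ _).
rewrite subr_le0; have [ri|ri] := boolP (i < r)%N; first by rewrite lerDl.
have Ni : (N - r <= i < N)%N by clear -ri ir iN; lia.
by rewrite Ni lerDr.
Qed.

End profile.

(** All that the product construction at scale T uses of the profile. In [profile_loss], [w i] is
    the displacement of the i-th lamp, and each factor is the mass that this displacement keeps in
    the interval. *)
Record lamp_profile {R : realType} (p T : R) (N : nat) (chi : int -> R) : Prop := {
  profile_ge0 : forall x, 0 <= chi x;
  profile_supp : forall x, chi x != 0 -> (0 <= x < N%:Z)%R;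
  profile_mass : \sum_(i < N) chi i%:Z `^ p = 1;
  profile_size : N%:R <= 8 * T;
  profile_gradient : \sum_(i < N + 2) `|chi i%:Z - chi (i%:Z - 1)| `^ p <=
    5 * (T `^ (p / (2 * p - 1))) `^ (- p);
  profile_loss : forall w : 'I_N -> int, 33 * T <= (\sum_i `|w i|)%:~R ->
    \prod_i (\sum_(x < N | (0 <= x%:Z + w i < N%:Z)%R) chi x%:Z `^ p) <=
    expR (- (2 `^ (1 - p) / 8)) }.

(** * Normalization of the taper to unit p-norm *)

Section normalized_taper.
Context {R : realType}.
Variables (p : R) (W r : nat).
Hypotheses (p1 : 1 <= p) (r0 : (0 < r)%N) (rW : (r <= W)%N).
Local Notation N := (4 * W)%N.
Local Notation Z := (\sum_(i < N) taper p W r i%:Z `^ p).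

Definition unit_taper (x : int) : R := taper p W r x / Z `^ p^-1.

Let p0 : 0 < p. Proof. exact: lt_le_trans ltr01 p1. Qed.
Let W0 : 0 < W%:R :> R. Proof. by rewrite ltr0n; clear -r0 rW; lia. Qed.

Let Z0 : 0 < Z.
Proof. apply: (@lt_le_trans _ _ (2 * W)%:R); last exact: taper_mass_ge.
by rewrite ltr0n; clear -r0 rW; lia. Qed.

Let Zp0 : 0 < Z `^ p^-1. Proof. exact: powR_gt0. Qed.

Let ZpE : (Z `^ p^-1) `^ p = Z.
Proof. by rewrite -powRrM mulVf ?gt_eqF// powRr1// ltW. Qed.

Lemma unit_taper_powR x : unit_taper x `^ p = taper p W r x `^ p / Z.
Proof. by rewrite powRM ?taper_ge0 ?invr_ge0 ?powR_ge0// inv_powR// ZpE. Qed.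

Lemma unit_taper_mass : \sum_(i < N) unit_taper i%:Z `^ p = 1.
Proof.
under eq_bigr do rewrite unit_taper_powR.
by rewrite -mulr_suml divff ?gt_eqF.
Qed.

(** The bound 9 W^(1-p) is divided by a mass of at least 2W, and 9/2 is rounded up to 5. *)
Lemma unit_taper_gradient :
  \sum_(i < N + 2) `|unit_taper i%:Z - unit_taper (i%:Z - 1)| `^ p <=
  5 * W%:R `^ (- p).
Proof.
have -> : \sum_(i < N + 2) `|unit_taper i%:Z - unit_taper (i%:Z - 1)| `^ p =
    (\sum_(i < N + 2) `|taper p W r i%:Z - taper p W r (i%:Z - 1)| `^ p) / Z.
  rewrite mulr_suml; apply: eq_bigr => i _.
  rewrite -mulrBl normrM [X in _ * X]ger0_norm ?invr_ge0 ?powR_ge0//.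
  by rewrite powRM ?invr_ge0 ?powR_ge0// inv_powR// ZpE.
rewrite ler_pdivrMr//; apply: (@le_trans _ _ (9 * W%:R `^ (1 - p))); first exact: taper_gradient.
apply: (@le_trans _ _ (5 * W%:R `^ (- p) * (2 * W)%:R)); last first.
  by rewrite ler_wpM2l ?mulr_ge0 ?powR_ge0// taper_mass_ge.
have -> : W%:R `^ (1 - p) = W%:R * W%:R `^ (- p).
  by rewrite powRD_gt0// powRr1 ?ltW.
have := mulr_ge0 (ltW W0) (powR_ge0 (W%:R : R) (- p)); rewrite natrM; lra.
Qed.

Lemma unit_taper_tail (v : int) : (`|v| <= N%:Z)%R ->
  (`|v|%:~R - 2 * r%:R) * ((r%:R / W%:R) `^ (p - 1) / N%:R) <=
  1 - \sum_(i < N | (0 <= i%:Z + v < N%:Z)%R) unit_taper i%:Z `^ p.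
Proof.
move=> vN.
have -> : 1 - \sum_(i < N | (0 <= i%:Z + v < N%:Z)%R) unit_taper i%:Z `^ p =
    \sum_(i < N | ~~ (0 <= i%:Z + v < N%:Z)%R) unit_taper i%:Z `^ p.
  rewrite -unit_taper_mass (bigID (fun i : 'I_N => (0 <= i%:Z + v < N%:Z)%R))/=.
  by rewrite addrAC subrr add0r.
(* For |v| <= 2r the left side is nonpositive; otherwise replacing the mass by its upper bound N
   only decreases the left side. *)
have [v0|v0] := leP (`|v|%:~R - 2 * r%:R) (0 : R).
  apply: (@le_trans _ _ 0); last by apply: sumr_ge0 => i _; exact: powR_ge0.
  by rewrite mulr_le0_ge0// divr_ge0 ?powR_ge0.
under eq_bigr do rewrite unit_taper_powR.
rewrite -mulr_suml mulrA; apply: (@le_trans _ _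
   ((`|v|%:~R - 2 * r%:R) * (r%:R / W%:R) `^ (p - 1) / Z)).
  apply: ler_wpM2l; first by rewrite mulr_ge0 ?powR_ge0// ltW.
  rewrite lef_pV2 ?posrE//; first exact: taper_mass_le.
  by rewrite ltr0n; clear -r0 rW; lia.
by rewrite ler_pM2r ?invr_gt0// taper_tail.
Qed.

(** Apply 1 - x <= exp(-x) to each factor. The 2r forfeited at each of the 4W sites add up to 8rW.
    If some displacement exceeds N, its factor is an empty sum and the product vanishes. *)
Lemma unit_taper_loss (w : 'I_N -> int) :
  \prod_i (\sum_(x < N | (0 <= x%:Z + w i < N%:Z)%R) unit_taper x%:Z `^ p) <=
  expR (- (((\sum_i `|w i|)%:~R - (8 * r * W)%:R) *
           ((r%:R / W%:R) `^ (p - 1) / N%:R))).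
Proof.
set c := _ / N%:R.
pose m i := \sum_(x < N | (0 <= x%:Z + w i < N%:Z)%R) unit_taper x%:Z `^ p.
have m0 i : 0 <= m i by apply: sumr_ge0 => x _; exact: powR_ge0.
have [wN|/existsNP[i /negP wi]] := pselect (forall i, (`|w i| <= N%:Z)%R); last first.
  rewrite (bigD1 i)//= [X in X * _](_ : _ = 0) ?mul0r ?expR_ge0//.
  by apply: big_pred0 => x; have := ltn_ord x; clear -wi; lia.
apply: (@le_trans _ _ (\prod_(i < N) expR (- ((`|w i|%:~R - 2 * r%:R) * c)))).
  apply: ler_prod => i _; rewrite m0/=; apply: le_trans (expR_ge1Dx _).
  by rewrite lerBrDl -lerBrDr unit_taper_tail.
rewrite -expR_sum ler_expR sumrN lerN2 -mulr_suml sumrB sumr_const card_ord.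
rewrite rmorph_sum/= le_eqVlt; apply/orP; left; apply/eqP; congr ((_ - _) * _).
by rewrite -[2 * _ *+ _]mulr_natr -!natrM; apply/eqP; rewrite eqr_nat; clear; lia.
Qed.

End normalized_taper.

Lemma lamp_profile_exists {R : realType} (p T : R) : 1 <= p -> 1 <= T ->
  exists N chi, lamp_profile p T N chi.
Proof.
move=> p1 T1; set q := p / (2 * p - 1).
have T0 : 0 < T by apply: lt_le_trans T1.
have d0 : 0 < 2 * p - 1 by move: p1; clear; lra.
have q1 : q <= 1 by rewrite /q ler_pdivrMr//; move: p1; clear; lra.
have qh : 1 - q <= q.
  suff : 1 <= 2 * q by clear; lra.
  by rewrite /q mulrA ler_pdivlMr//; move: p1; clear; lra.
(* Up to rounding, [A] and [B] are the widths of the broad and the steep ramp. Since 1 - q <= q, the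
   steep one is the shorter. *)
pose A := T `^ q; pose B := T `^ (1 - q).
have powT_ge1 a : 0 <= a -> 1 <= T `^ a.
  by move=> a0; rewrite -[leLHS](powRr0 T) ler_powR.
have A1 : 1 <= A by apply: powT_ge1; move: qh q1; clear; lra.
have B1 : 1 <= B by apply: powT_ge1; move: q1; clear; lra.
have BA : B <= A by apply: ler_powR.
have AB : A * B = T.
  by rewrite -powRD_gt0// addrCA subrr addr0 powRr1// ltW.
pose W := (Num.truncn A).+1; pose r := (Num.truncn B).+1.
have AW : A <= W%:R by rewrite ltW// truncnS_gt.
have WA : W%:R <= 2 * A.
  have : (Num.truncn A)%:R <= A by rewrite truncn_le// (le_trans ler01).
  by rewrite /W -natr1; move: A1; clear; lra.
have Br : B <= r%:R by rewrite ltW// truncnS_gt.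
have rB : r%:R <= 2 * B.
  have : (Num.truncn B)%:R <= B by rewrite truncn_le// (le_trans ler01).
  by rewrite /r -natr1; move: B1; clear; lra.
have r0 : (0 < r)%N by [].
have rW : (r <= W)%N by rewrite ltnS le_truncn.
have W0 : 0 < W%:R :> R by rewrite ltr0n.
exists (4 * W)%N, (unit_taper p W r); split.
- by move=> x; rewrite divr_ge0 ?taper_ge0 ?powR_ge0.
- by move=> x; rewrite mulf_eq0 negb_or => /andP[/(taper_neq0 p1 r0 rW)].
- exact: unit_taper_mass.
- rewrite natrM; suff : A <= T by move: WA; clear; lra.
  by rewrite -AB ler_peMr// (le_trans ler01).
- apply: le_trans (unit_taper_gradient p1 r0 rW) _.
  rewrite ler_pM2l// !powRN lef_pV2 ?posrE ?powR_gt0//; try exact: lt_le_trans A1.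
  apply: ge0_ler_powR; rewrite ?nnegrE ?powR_ge0//; exact: le_trans p1.
- move=> w w_ge; apply: le_trans (unit_taper_loss p1 r0 rW w) _.
  rewrite ler_expR lerN2.
  (* The forfeited amount is at most 32T, so the threshold 33T leaves a displacement of at least
     T. *)
  have rWT : (8 * r * W)%:R <= 32 * T.
    rewrite !natrM -AB; move: WA rB A1 B1 AW Br; clear; nra.
  apply: (@le_trans _ _ (T * ((r%:R / W%:R) `^ (p - 1) / (4 * W)%:R))); last first.
    rewrite ler_wpM2r ?divr_ge0 ?powR_ge0//; move: w_ge rWT; clear; lra.
  have A0 : 0 < A := lt_le_trans ltr01 A1.
  have B0 : 0 < B := lt_le_trans ltr01 B1.
  (* This is what fixes q: (1 - q) p = q (p - 1), that is B^p = A^(p-1), so the powers of T cancel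
     and the loss has a bound independent of the scale. *)
  have pA : 2 `^ (1 - p) = (B / (2 * A)) `^ (p - 1) * B.
    have BE : B `^ (p - 1) * B = A `^ (p - 1).
      rewrite -{2}[B]powRr1; last exact: ltW.
      rewrite -(powRD_gt0 _ _ B0) subrK /A /B -[LHS]powRrM -[RHS]powRrM.
      congr (_ `^ _).
      by rewrite /q; field; rewrite gt_eqF.
    rewrite powRM ?invr_ge0 ?mulr_ge0//; [|exact: ltW..].
    rewrite mulrAC BE inv_powR ?mulr_gt0// powRM//; last exact: ltW.
    rewrite invfM mulrCA divff ?gt_eqF ?powR_gt0// mulr1 -powRN.
    by congr (_ `^ _); clear; ring.
  rewrite pA -AB.
  have le1 : (B / (2 * A)) `^ (p - 1) <= (r%:R / W%:R) `^ (p - 1).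
    apply: ge0_ler_powR; rewrite ?nnegrE ?subr_ge0 ?divr_ge0 ?mulr_ge0//; try exact: ltW.
    rewrite ler_pM ?invr_ge0 ?mulr_ge0//; try exact: ltW.
    by rewrite lef_pV2 ?posrE ?mulr_gt0.
  have : W%:R^-1 >= (2 * A)^-1 by rewrite lef_pV2 ?posrE ?mulr_gt0.
  move: le1; set X := _ `^ _; set Y := _ `^ _ => XY WV.
  have X0 : 0 <= X by exact: powR_ge0.
  have -> : X * B / 8 = (A * B / 4) * (X * (2 * A)^-1) by field; rewrite gt_eqF.
  have -> : A * B * (Y / (4 * W)%:R) = (A * B / 4) * (Y * W%:R^-1).
    by rewrite natrM; field; rewrite gt_eqF.
  rewrite ler_wpM2l// ?divr_ge0// ?mulr_ge0//; try exact: ltW.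
  by rewrite ler_pM// invr_ge0 mulr_ge0// ltW.
Qed.

(** * Words in Z wr Z *)

Definition window (M : int) (N : nat) : pred int :=
  fun x => (M <= x < M + N%:Z)%R.

Definition lamp_window (M : int) (N : nat) (w : nat -> int) : lamps :=
  [fsfun x in [fset (M + i%:Z)%R | i in iota 0 N]%fset => w `|(x - M)%R|%N].

Lemma lamp_windowE M N w x :
  lamp_window M N w x = if window M N x then w `|x - M|%N else 0.
Proof.
rewrite fsfunE; congr (if _ then _ else _); apply/imfsetP/idP => /=.
  by move=> [i]; rewrite mem_iota /window => iN ->; lia.
rewrite /window => xM; exists `|x - M|%N; first by rewrite mem_iota; lia.
by lia.
Qed.

Lemma ZwrZ_mul_lampE (g h : ZwrZ) x : (g * h)%g.2 x = g.2 x + h.2 (x - g.1).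
Proof. by rewrite ZwrZ_mulE/= lampsD lamp_shiftE. Qed.

(** With [lamp_add], the standard generators for arguments 1 and -1. Right multiplication by them
    moves the cursor, respectively changes the lamp under the cursor. *)
Definition cursor_move (n : int) : ZwrZ := (n, 0).
Definition lamp_add (x : int) : ZwrZ := (0, lamp_window 0 1 (fun=> x)).

Lemma cursor_moveE (y : ZwrZ) n : (y * cursor_move n)%g = (y.1 + n, y.2).
Proof.
rewrite ZwrZ_mulE/=; congr pair; apply/fsfunP => x.
by rewrite lampsD lamp_shiftE lamps0 addr0.
Qed.

Lemma lamp_addE (y : ZwrZ) (a x : int) :
  ((y * lamp_add a)%g.2 x = y.2 x + (if x == y.1 then a else 0))%R.
Proof.
have xy (z c : int) : (0 <= z - c < 0 + 1%:Z)%R = (z == c) by lia.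
by rewrite ZwrZ_mul_lampE lamp_windowE /window xy.
Qed.

Lemma lamp_add_cursor (y : ZwrZ) (a : int) : (y * lamp_add a)%g.1 = y.1.
Proof. by rewrite ZwrZ_mulE/= addr0. Qed.

Lemma cursor_moveD m n : cursor_move (m + n) = (cursor_move m * cursor_move n)%g.
Proof. by rewrite cursor_moveE. Qed.

Lemma ZwrZ_eqP (g h : ZwrZ) : g.1 = h.1 -> (forall x, g.2 x = h.2 x) -> g = h.
Proof. by case: g h => [m u] [n v] /= -> uv; congr pair; apply/fsfunP. Qed.

Lemma lamp_addD x y : lamp_add (x + y) = (lamp_add x * lamp_add y)%g.
Proof.
apply: ZwrZ_eqP => [|z]; first by rewrite lamp_add_cursor.
by rewrite lamp_addE/= !lamp_windowE /window; case: ifP; case: ifP; lia.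
Qed.

Section word_bound.
(** [Q n g] reads: g can be obtained at cost n. It is instantiated by word length, and with C = 0 by
    a property stable under products. *)
Variables (Q : nat -> ZwrZ -> Prop) (C : nat).
Hypotheses (Q1 : Q 0 1%g)
  (QM : forall m n g h, Q m g -> Q n h -> Q (m + n)%N (g * h)%g)
  (Qcursor : forall e : int, `|e|%N = 1%N -> Q C (cursor_move e))
  (Qlamp : forall e : int, `|e|%N = 1%N -> Q C (lamp_add e)).

Lemma morphism_word_bound (phi : int -> ZwrZ) :
  (forall x y, phi (x + y) = phi x * phi y)%g ->
  (forall e : int, `|e|%N = 1%N -> Q C (phi e)) ->
  forall x, Q (C * `|x|)%N (phi x).
Proof.
move=> phiD Qphi x.
have phi0 : phi 0 = 1%g.
  by apply: (mulgI (phi 0)); rewrite mulg1 -phiD addr0.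
have [n [e [-> e1]]] : exists n : nat, exists e : int, x = e *+ n /\ `|e|%N = 1%N.
  exists `|x|%N, (if (0 <= x)%R then 1 else -1).
  by split; case: ifP => x0; rewrite ?mulNrn; lia.
have -> : (C * `|e *+ n| = n * C)%N.
  by rewrite -mulr_natr natz abszM e1 mul1n mulnC.
elim: n => [|n IH]; first by rewrite mulr0n phi0.
by rewrite mulrS phiD mulSn; apply: QM => //; exact: Qphi.
Qed.

(** Visit the sites from left to right: set the lamp under the cursor, then step to the right. *)
Lemma sweep_word_bound n (w : nat -> int) :
  Q (C * (n + \sum_(i < n) `|w i|))%N (n%:Z, lamp_window 0 n w).
Proof.
elim: n => [|n IH].
  rewrite big_ord0 muln0 (_ : (_, _) = 1%g :> ZwrZ)//.
  by apply: ZwrZ_eqP => // x; rewrite lamp_windowE /window/= lamps0; case: ifP; lia.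
have -> : (C * (n.+1 + \sum_(i < n.+1) `|w i|) =
    C * (n + \sum_(i < n) `|w i|) + (C * `|w n| + C * `|1%Z|))%N.
  by rewrite big_ord_recr/= -!mulnDr; congr (_ * _)%N; clear; lia.
set y : ZwrZ := (n%:Z, _) in IH.
have -> : (n.+1%:Z, lamp_window 0 n.+1 w) =
    (y * (lamp_add (w n) * cursor_move 1))%g :> ZwrZ.
  rewrite mulgA cursor_moveE; apply: ZwrZ_eqP => [|x].
    by rewrite lamp_add_cursor/=; lia.
  rewrite lamp_addE/= !lamp_windowE /window.
  have [->|xn] := eqVneq x n%:Z.
    by rewrite subr0 absz_nat ifT ?ifF ?add0r//; lia.
  by rewrite addr0; case: ifP; case: ifP => //; lia.
apply: QM => //; apply: QM; apply: morphism_word_bound => //.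
- exact: lamp_addD.
- exact: cursor_moveD.
Qed.

(** Go to -B, sweep the 2B + 1 sites while setting the lamps, then go to the final cursor. The moves
    number at most B + (2B + 1) + (2B + 1) = 5B + 2. *)
Lemma word_bound (g : ZwrZ) (B : nat) :
  (`|g.1| <= B)%N -> (forall x, g.2 x != 0 -> (`|x| <= B)%N) ->
  exists2 n, (n <= C * (5 * B + 2 + \sum_(i < 2 * B + 1) `|g.2 (i%:Z - B%:Z)%R|))%N &
    Q n g.
Proof.
move=> gB vB; pose w (i : nat) : int := g.2 (i%:Z - B%:Z).
exists (C * `|- B%:Z| + (C * (2 * B + 1 + \sum_(i < 2 * B + 1) `|w i|) +
  C * `|(g.1 - B%:Z - 1)%R|))%N.
  by rewrite /w -!mulnDr leq_mul2l; apply/orP; right; lia.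
(* The sweep leaves the cursor at B + 1, hence the last displacement. *)
have gE : g = (cursor_move (- B%:Z) * ((((2 * B + 1)%N%:Z, lamp_window 0 (2 * B + 1) w) : ZwrZ)
    * cursor_move (g.1 - B%:Z - 1)))%g.
  rewrite cursor_moveE ZwrZ_mulE; apply: ZwrZ_eqP => [|x]/=; first by lia.
  rewrite lampsD lamps0 add0r lamp_shiftE lamp_windowE /window; case: ifP => xB.
    by rewrite /w; congr (g.2 _); lia.
  by apply/eqP; apply: contraFT xB => /vB; lia.
rewrite [X in Q _ X]gE; apply: QM; last apply: QM.
- by apply: morphism_word_bound => //; exact: cursor_moveD.
- exact: sweep_word_bound.
- by apply: morphism_word_bound => //; exact: cursor_moveD.
Qed.

End word_bound.

(** * Word length for an arbitrary finite symmetric generating set *)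

Section word_length_bounds.
Variables (S : set ZwrZ) (Sfin : finite_set S) (Ssym : symmetric_set S)
  (Sgen : generating S).

Lemma set_expM m n g h :
  set_exp S m g -> set_exp S n h -> set_exp S (m + n) (g * h)%g.
Proof.
elim: m g => [|m IH] g /=; first by move=> ->; rewrite mul1g.
by move=> [x Sx [y Sy <-]] Sh; exists x => //; exists (y * h)%g; rewrite ?mulgA//; exact: IH.
Qed.

(** The elements represented by words form a subgroup containing S, closed under inverses because S
    is symmetric. *)
Lemma set_exp_total g : exists n, set_exp S n g.
Proof.
have S1 x : S x -> set_exp S 1 x by move=> Sx; exists x => //; exists 1%g; rewrite ?mulg1.
suff : [set g | exists n, set_exp S n g] = setT by move=> /seteqP[_ /(_ g)]; exact.
apply: Sgen => [|x Sx]; last by exists 1%N; exact: S1.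
split; first by exists 0%N.
  by move=> x y [m Sx] [n Sy]; exists (m + n)%N; exact: set_expM.
move=> x [n]; elim: n x => [x ->|n IH x [s Ss [y Sy <-]]].
  by rewrite invg1; exists 0%N.
have [m Sm] := IH _ Sy; exists (m + 1)%N; rewrite invgM.
by apply: set_expM => //; apply: S1; exact: Ssym.
Qed.

(** Fix one word in S for each of the four standard generators; their total length serves as cost of
    a single move. *)
Lemma set_exp_bound : exists2 C, (0 < C)%N & forall (g : ZwrZ) (B : nat),
  (`|g.1| <= B)%N -> (forall x, g.2 x != 0 -> (`|x| <= B)%N) ->
  exists2 n, (n <= C * (5 * B + 2 + \sum_(i < 2 * B + 1) `|g.2 (i%:Z - B%:Z)%R|))%N &
    set_exp S n g.
Proof.
have [a Sa] := set_exp_total (cursor_move 1).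
have [b Sb] := set_exp_total (cursor_move (-1)).
have [c Sc] := set_exp_total (lamp_add 1).
have [d Sd] := set_exp_total (lamp_add (-1)).
pose Q n g := exists2 m, (m <= n)%N & set_exp S m g.
exists (a + b + c + d + 1)%N; first by lia.
have abs1 (e : int) : `|e|%N = 1%N -> e = 1 \/ e = -1 by lia.
move=> g B gB vB.
have [||||n nC [m mn Sm]] := @word_bound Q (a + b + c + d + 1)%N _ _ _ _ g B gB vB.
- by exists 0%N.
- move=> m n x y [m' m'm Sx] [n' n'n Sy]; exists (m' + n')%N; first by lia.
  exact: set_expM.
- by move=> e /abs1[->|->]; [exists a|exists b] => //; lia.
- by move=> e /abs1[->|->]; [exists c|exists d] => //; lia.
- by exists m => //; exact: leq_trans nC.
Qed.

(** The cursor is additive under products, so each letter moves it by a bounded amount. *)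
Lemma cursor_bound : exists C, forall n (g : ZwrZ), set_exp S n g -> (`|g.1| <= C * n)%N.
Proof.
pose X := fset_set S; exists (\sum_(x <- X) `|x.1|)%N.
elim=> [g ->|n IH g [x Sx [y Sy <-]]]; first by rewrite muln0.
have xC : (`|x.1| <= \sum_(x <- X) `|x.1|)%N.
  have xX : x \in X by rewrite in_fset_set// inE.
  by rewrite (big_rem x)//= leq_addr.
have absD (a b : int) c d : (`|a| <= c -> `|b| <= d -> `|(a + b)%R| <= c + d)%N by lia.
by rewrite ZwrZ_mulE/= mulnS; apply: absD => //; exact: IH.
Qed.

End word_length_bounds.

(** * Product bumps *)

Section box_bump.
Context {R : realType} {p T : R} {N : nat} {chi : int -> R}.
Hypotheses (p1 : 1 <= p) (chiP : lamp_profile p T N chi).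
Variable M : int.
Local Notation gradient := (5 * (T `^ (p / (2 * p - 1))) `^ (- p)).

Definition supported_in (u : lamps) : bool := all (window M N) (finsupp u).

Lemma supported_inP (u : lamps) : reflect (forall x, u x != 0 -> window M N x) (supported_in u).
Proof.
apply: (iffP allP) => h x; first by rewrite -mem_finsupp; exact: h.
by rewrite mem_finsupp; exact: h.
Qed.

Definition box_bump (y : ZwrZ) : R :=
  chi (y.1 - M) *
  (if supported_in y.2 then \prod_(i < N) chi (y.2 (M + i%:Z)) else 0).

Lemma box_bump_ge0 y : 0 <= box_bump y.
Proof.
rewrite mulr_ge0 ?(profile_ge0 chiP)//; case: ifP => // _.
by apply: prodr_ge0 => i _; exact: profile_ge0 chiP _.
Qed.

Lemma box_bump_neq0 y : box_bump y != 0 ->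
  [/\ window M N y.1, forall x, y.2 x != 0 -> window M N x &
      forall i, (i < N)%N -> (0 <= y.2 (M + i%:Z) < N%:Z)%R].
Proof.
rewrite mulf_eq0 negb_or => /andP[/(profile_supp chiP) yM].
case: ifP => [/supported_inP uM|]; last by rewrite eqxx.
move=> /prodf_neq0 un0; split=> // [|i iN]; first by rewrite /window; lia.
by apply: (profile_supp chiP); exact: (un0 (Ordinal iN)).
Qed.

(* For o = 0 and P = N these are the configurations of the box; for o = 1 and
   P = N + 2, also those sent into it by a generator. *)
Definition config (o P : nat) (cw : 'I_P * {ffun 'I_N -> 'I_P}) : ZwrZ :=
  (M + cw.1%:Z - o%:Z,
   lamp_window M N (fun i => if insub i is Some i' then (cw.2 i')%:Z - o%:Z else 0)).

Lemma config_site o P cw (i : 'I_N) :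
  (@config o P cw).2 (M + i%:Z) = (cw.2 i)%:Z - o%:Z.
Proof.
rewrite lamp_windowE ifT; last by rewrite /window; have := ltn_ord i; lia.
have -> : `|(M + i%:Z - M)%R|%N = i by lia.
by rewrite insubT//= => iN; congr (Posz (cw.2 _) - _); exact: val_inj.
Qed.

Lemma config_supported o P cw x : (@config o P cw).2 x != 0 -> window M N x.
Proof. by rewrite lamp_windowE; case: ifP => //; rewrite eqxx. Qed.

Lemma config_inj o P : injective (@config o P).
Proof.
move=> cw cw' e; have e1 := congr1 fst e.
have e2 (i : 'I_N) : (cw.2 i)%:Z - o%:Z = (cw'.2 i)%:Z - o%:Z.
  by rewrite -!config_site e.
case: cw cw' e1 e2 {e} => [c w] [c' w'] /= e1 e2; congr pair.
  by apply: val_inj => /=; move: e1; clear; lia.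
by apply/ffunP => i; apply: val_inj => /=; move: (e2 i); clear; lia.
Qed.

Lemma config_surj o P (y : ZwrZ) :
  (0 <= y.1 - M + o%:Z < P%:Z)%R -> (forall x, y.2 x != 0 -> window M N x) ->
  (forall i, (i < N)%N -> (0 <= y.2 (M + i%:Z) + o%:Z < P%:Z)%R) ->
  exists cw, @config o P cw = y.
Proof.
move=> y1P ysupp yP.
have c_lt : (`|(y.1 - M + o%:Z)%R|%N < P)%N by clear -y1P; lia.
have w_lt (i : 'I_N) : (`|(y.2 (M + i%:Z) + o%:Z)%R|%N < P)%N.
  by move: (yP i (ltn_ord i)); clear; lia.
exists (Ordinal c_lt, [ffun i => Ordinal (w_lt i)]).
apply: ZwrZ_eqP => [|x] /=; first by clear -y1P; lia.
have [xM|xM] := boolP (window M N x); last first.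
  by rewrite lamp_windowE (negbTE xM); apply/esym/eqP; apply: contraNT xM => /ysupp.
have iN : (`|(x - M)%R|%N < N)%N by move: xM; rewrite /window; clear; lia.
have xE : x = M + (Ordinal iN)%:Z by move: xM; rewrite /window/=; clear; lia.
rewrite xE; transitivity ((@config o P (Ordinal c_lt, [ffun i => Ordinal (w_lt i)])).2
  (M + (Ordinal iN)%:Z)); first by [].
rewrite config_site ffunE/=.
by move: (yP _ iN); clear; lia.
Qed.

Lemma box_bump_config o P cw :
  box_bump (@config o P cw) = chi (cw.1%:Z - o%:Z) * \prod_i chi ((cw.2 i)%:Z - o%:Z).
Proof.
rewrite /box_bump ifT; last by apply/supported_inP; exact: config_supported.
congr (chi _ * _); first by rewrite /=; lia.
by apply: eq_bigr => i _; rewrite config_site.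
Qed.

Lemma powR_prod (I : finType) (F : I -> R) : (forall i, 0 <= F i) ->
  (\prod_i F i) `^ p = \prod_i F i `^ p.
Proof.
move=> F0; suff [//] : 0 <= \prod_i F i /\ (\prod_i F i) `^ p = \prod_i F i `^ p.
apply: (big_ind2 (fun x y => 0 <= x /\ x `^ p = y)) => [|x x' y y' [x0 <-] [y0 <-]|i _].
- by rewrite powR1.
- by rewrite mulr_ge0// powRM.
- by [].
Qed.

(** Distributivity over the lamps for a fixed cursor. The factors may depend on the cursor, as a
    lamp generator acts only at its site. *)
Lemma sum_config P (F : 'I_P -> R) (G : 'I_P -> 'I_N -> 'I_P -> R) :
  \sum_(cw : 'I_P * {ffun 'I_N -> 'I_P}) F cw.1 * \prod_i G cw.1 i (cw.2 i) =
  \sum_c F c * \prod_i \sum_x G c i x.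
Proof.
rewrite -(pair_bigA _ (fun c (w : {ffun _ -> _}) => F c * \prod_i G c i (w i)))/=.
by apply: eq_bigr => c _; rewrite -mulr_sumr bigA_distr_bigA.
Qed.

Lemma profile_shifted_mass : \sum_(x < N + 2) chi (x%:Z - 1) `^ p = 1.
Proof.
have chi0 x : ~~ (0 <= x < N%:Z)%R -> chi x `^ p = 0.
  move=> xN; have -> : chi x = 0.
    by apply/eqP; apply: contraNT xN => /(profile_supp chiP).
  by rewrite powR0// gt_eqF// (lt_le_trans ltr01).
rewrite addn2 big_ord_recl/= chi0// add0r big_ord_recr/= addrC chi0 ?add0r; last first.
  by rewrite /= /fintype.bump; clear; lia.
rewrite -[RHS](profile_mass chiP); apply: eq_bigr => i _.
by congr (chi _ `^ _); rewrite /= /fintype.bump; clear; lia.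
Qed.

Local Notation mu := (counting : {measure set (discrete_group ZwrZ) -> \bar R}).

(** The integrand vanishes unless x^-1 or x^-1 s lies in the box; in either case x^-1 is an enlarged
    configuration. *)
Lemma box_bump_variation_le (s : ZwrZ) :
  (forall y, box_bump (y * s)%g != 0 -> exists cw, @config 1 (N + 2) cw = y) ->
  (\int[mu]_(x in setT) (`|box_bump (x^-1 * s)%g - box_bump x^-1%g| `^ p)%:E <=
   (\sum_cw `|box_bump (@config 1 (N + 2) cw * s)%g - box_bump (@config 1 (N + 2) cw)| `^ p)%:E)%E.
Proof.
move=> sP; have p0 : p != 0 by rewrite gt_eqF// (lt_le_trans ltr01).
apply: le_trans.
  apply: (@counting_integral_le _ _ _ (fun cw => (@config 1 (N + 2) cw)^-1%g)).
    by move=> y; exact: powR_ge0.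
  move=> y; have [y0|yn0 _] := eqVneq (box_bump y^-1%g) 0.
    have [ys0|/sP[cw cwy] _] := eqVneq (box_bump (y^-1 * s)%g) 0.
      by rewrite y0 ys0 subrr normr0 powR0// eqxx.
    by exists cw; rewrite cwy invgK.
  have [y1 y2 y3] := box_bump_neq0 yn0.
  have [||cw cwy] := @config_surj 1 (N + 2) y^-1%g _ y2.
  - by move: y1; rewrite /window; clear; lia.
  - by move=> i /y3; clear; lia.
  - by exists cw; rewrite cwy invgK.
by under eq_bigr do rewrite invgK.
Qed.

(** Only the cursor factor changes; each lamp factor sums to 1 and the gradient of the profile
    remains. *)
Lemma box_bump_cursor_variation :
  (\int[mu]_(x in setT) (`|box_bump (x^-1 * cursor_move 1)%g - box_bump x^-1%g| `^ p)%:E <=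
   gradient%:E)%E.
Proof.
apply: le_trans (box_bump_variation_le _) _ => [y /box_bump_neq0[]|].
  rewrite cursor_moveE => /= y1 y2 y3; apply: config_surj => //.
  - by move: y1; rewrite /window; clear; lia.
  - by move=> i /y3; clear; lia.
rewrite lee_fin.
have -> : \sum_cw `|box_bump (@config 1 (N + 2) cw * cursor_move 1)%g -
    box_bump (@config 1 (N + 2) cw)| `^ p =
  \sum_(cw : 'I_(N + 2) * {ffun 'I_N -> 'I_(N + 2)})
    `|chi cw.1%:Z - chi (cw.1%:Z - 1)| `^ p * \prod_i chi ((cw.2 i)%:Z - 1) `^ p.
  apply: eq_bigr => cw _; rewrite box_bump_config cursor_moveE.
  have -> : box_bump ((config 1 cw).1 + 1, (config 1 cw).2) =
      chi cw.1%:Z * \prod_i chi ((cw.2 i)%:Z - 1).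
    rewrite /box_bump /= ifT; last by apply/supported_inP; exact: config_supported.
    congr (chi _ * _); first by lia.
    by apply: eq_bigr => i _; rewrite config_site.
  rewrite -mulrBl normrM powRM// [X in _ * X `^ _]ger0_norm ?powR_prod//.
  - by move=> i; exact: profile_ge0 chiP _.
  - by apply: prodr_ge0 => i _; exact: profile_ge0 chiP _.
rewrite (sum_config (fun c => `|chi c%:Z - chi (c%:Z - 1)| `^ p)
  (fun _ _ x => chi (x%:Z - 1) `^ p)).
rewrite (eq_bigr (fun c : 'I_(N + 2) => `|chi c%:Z - chi (c%:Z - 1)| `^ p)).
  exact: profile_gradient chiP.
by move=> c _; rewrite big1 ?mulr1// => i _; exact: profile_shifted_mass.
Qed.

(** For a fixed cursor only the factor of the lamp under it changes, so the sum over lamps is one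
    gradient times factors 1; the cursor weights then sum to 1. *)
Lemma box_bump_lamp_variation :
  (\int[mu]_(x in setT) (`|box_bump (x^-1 * lamp_add 1)%g - box_bump x^-1%g| `^ p)%:E <=
   gradient%:E)%E.
Proof.
apply: le_trans (box_bump_variation_le _) _ => [y /box_bump_neq0[]|].
  rewrite lamp_add_cursor => y1 y2 y3; apply: config_surj.
  - by move: y1; rewrite /window; clear; lia.
  - move=> x yx; have [->//|xy] := eqVneq x y.1.
    by apply: y2; rewrite lamp_addE (negbTE xy) addr0.
  - by move=> i /y3; rewrite lamp_addE; case: ifP => _; clear; lia.
rewrite lee_fin.
(* The cursor of the enlarged configuration stands at M + c - 1, so i is its site when c - 1 = i. *)
pose G (c : 'I_(N + 2)) (i : 'I_N) (x : 'I_(N + 2)) : R :=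
  if c%:Z - 1 == i%:Z then `|chi x%:Z - chi (x%:Z - 1)| `^ p else chi (x%:Z - 1) `^ p.
have p0 : p != 0 by rewrite gt_eqF// (lt_le_trans ltr01).
have -> : \sum_cw `|box_bump (@config 1 (N + 2) cw * lamp_add 1)%g -
    box_bump (@config 1 (N + 2) cw)| `^ p =
  \sum_(cw : 'I_(N + 2) * {ffun 'I_N -> 'I_(N + 2)})
    chi (cw.1%:Z - 1) `^ p * \prod_i G cw.1 i (cw.2 i).
  apply: eq_bigr => -[c w] _ /=.
  have [chi0|] := eqVneq (chi (c%:Z - 1)) 0.
    rewrite box_bump_config/= chi0 mul0r subr0 powR0// mul0r /box_bump lamp_add_cursor/=.
    have -> : M + c%:Z - 1%:Z - M = c%:Z - 1 by clear; lia.
    by rewrite chi0 mul0r normr0 powR0.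
  move=> /(profile_supp chiP) cN.
  have jN : (`|(c%:Z - 1)%R|%N < N)%N by clear -cN; lia.
  pose j : 'I_N := Ordinal jN.
  have jE (i : 'I_N) : (c%:Z - 1 == i%:Z) = (i == j).
    have jE' (a b : nat) : (0 <= a%:Z - 1)%R -> (a%:Z - 1 == b%:Z) = (b == `|(a%:Z - 1)%R|%N).
      by clear; lia.
    by rewrite -val_eqE/= jE'//; case/andP: cN.
  have -> : box_bump (config 1 (c, w) * lamp_add 1)%g = chi (c%:Z - 1) *
      (chi (w j)%:Z * \prod_(i < N | i != j) chi ((w i)%:Z - 1)).
    rewrite /box_bump lamp_add_cursor ifT; last first.
      apply/supported_inP => x; rewrite lamp_addE.
      have [-> _|_] := eqVneq x; first by rewrite /window/=; clear -cN; lia.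
      by rewrite addr0; exact: config_supported.
    congr (chi _ * _); first by rewrite /=; clear; lia.
    rewrite (eq_bigr (fun i : 'I_N => chi ((w i)%:Z - 1 + (if i == j then 1 else 0)))).
      rewrite (bigD1 j)//= eqxx subrK; congr (_ * _).
      by apply: eq_bigr => i ij; rewrite (negbTE ij) addr0.
    move=> i _; rewrite lamp_addE config_site/= -jE; congr (chi (_ + _)).
    by congr (if _ then _ else _); clear; lia.
  have -> : box_bump (config 1 (c, w)) = chi (c%:Z - 1) *
      (chi ((w j)%:Z - 1) * \prod_(i < N | i != j) chi ((w i)%:Z - 1)).
    by rewrite box_bump_config/= (bigD1 j).
  rewrite -mulrBr -mulrBl.
  rewrite [in RHS](bigD1 j)//= /G jE eqxx.
  have prod0 : 0 <= \prod_(i < N | i != j) chi ((w i)%:Z - 1).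
    by apply: prodr_ge0 => i _; exact: profile_ge0 chiP _.
  rewrite !normrM !powRM// ?mulr_ge0// (ger0_norm prod0).
  rewrite (ger0_norm (profile_ge0 chiP (c%:Z - 1))).
  congr (_ * (_ * _)); rewrite big_mkcond powR_prod; last first.
    by move=> i; case: ifP => // _; exact: profile_ge0 chiP _.
  rewrite [RHS]big_mkcond; apply: eq_bigr => i _.
  by rewrite jE; case: eqP => //= _; rewrite powR1.
rewrite (sum_config (fun c => chi (c%:Z - 1) `^ p) G).
apply: (@le_trans _ _ (\sum_(c < N + 2) chi (c%:Z - 1) `^ p * gradient)); last first.
  by rewrite -mulr_suml profile_shifted_mass mul1r.
apply: ler_sum => c _; have [/(profile_supp chiP) cN|] := boolP (chi (c%:Z - 1) != 0).
  rewrite ler_wpM2l ?powR_ge0//.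
  have jN : (`|(c%:Z - 1)%R|%N < N)%N by clear -cN; lia.
  rewrite (bigD1 (Ordinal jN))//= [X in _ * X]big1 ?mulr1.
    rewrite (eq_bigr (fun x : 'I_(N + 2) => `|chi x%:Z - chi (x%:Z - 1)| `^ p)).
      exact: profile_gradient chiP.
    by move=> x _; rewrite /G ifT//=; clear -cN; lia.
  move=> i; rewrite -val_eqE/= => ij.
  rewrite -[RHS]profile_shifted_mass; apply: eq_bigr => x _; rewrite /G ifF//.
  by clear -cN ij; lia.
by rewrite negbK => /eqP ->; rewrite powR0// !mul0r.
Qed.

(** * Escape of the box under a long element *)

Section escape.
Variables (g : ZwrZ).
Hypothesis g_long : (`|g.1| < N)%N -> (forall x, g.2 x != 0 -> (`|x| < N)%N) ->
  33 * T <= (\sum_(i < 2 * N + 1) `|g.2 (i%:Z - N%:Z)%R|)%N%:R.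

(** With the cursor at M + c, g adds [v i] to the lamp at M + i, and a configuration that stays in
    the box has all its displaced values in the interval; [profile_loss] bounds their mass. If one
    configuration stays, then g has small radius and [g_long] applies; otherwise the sum is
    empty. *)
Lemma kept_mass (c : 'I_N) :
  \sum_(w : {ffun 'I_N -> 'I_N} | box_bump (@config 0 N (c, w) * g)%g != 0)
    \prod_i chi (w i)%:Z `^ p <= expR (- (2 `^ (1 - p) / 8)).
Proof.
pose v (i : 'I_N) : int := g.2 (i%:Z - c%:Z).
have [[w kept]|none] := pselect (exists w, box_bump (@config 0 N (c, w) * g)%g != 0);
    last first.
  by rewrite big1 ?expR_ge0// => w kept; exfalso; apply: none; exists w.
have [k1 k2 _] := box_bump_neq0 kept.
(* A nonzero lamp of g is added either to a nonzero lamp, already in the window, or to a zero one,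
   and then the result must lie in the window. *)
have gN x : g.2 x != 0 -> window 0 N (x + c%:Z).
  move=> gx; have := k2 (M + c%:Z + x); have := @config_supported 0 N (c, w) (M + c%:Z + x).
  rewrite ZwrZ_mul_lampE [in g.2 _](_ : _ - _ = x); last by rewrite /=; clear; lia.
  set u := (config _ _).2 _; have [->|un0] := eqVneq u 0.
    by move=> _; rewrite add0r => /(_ gx); rewrite /window; clear; lia.
  by move=> /(_ isT) + _; rewrite /window; clear; lia.
have cN := ltn_ord c.
have g1N : (`|g.1| < N)%N.
  by move: k1; rewrite ZwrZ_mulE/= /window; move: (g.1) cN => a; clear; lia.
have g2N x : g.2 x != 0 -> (`|x| < N)%N.
  by move=> /gN; rewrite /window; clear -cN; lia.
have vT : 33 * T <= (\sum_i `|v i|)%:~R.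
  apply: le_trans (g_long g1N g2N) _.
  have -> : \sum_(i < N) `|v i| = (\sum_(i < N) `|v i|%N)%N%:Z.
    by rewrite -[RHS]natz natr_sum; apply: eq_bigr => i _; rewrite natz abszE.
  rewrite -[leRHS]/(_%:R) ler_nat.
  rewrite -(big_mkord predT (fun i => `|g.2 (i%:Z - N%:Z)%R|%N)).
  (* Index i stands for position i - N. Only the positions from -c to N - c - 1 can carry a lamp of
     g, so the two outer ranges vanish. *)
  rewrite (@big_cat_nat _ _ _ (N - c))/=; [|clear; lia..].
  rewrite (@big_cat_nat _ _ _ (N - c + N) (N - c))/=; [|clear -cN; lia..].
  have out0 i : ~~ window 0 N (i%:Z - N%:Z + c%:Z) -> `|g.2 (i%:Z - N%:Z)%R|%N = 0%N.
    by move=> iN; apply/eqP; rewrite absz_eq0; apply: contraNT iN => /gN.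
  have -> : (\sum_(0 <= i < N - c) `|g.2 (i%:Z - N%:Z)%R|%N = 0)%N.
    rewrite big_nat_cond big1// => i /andP[iN _].
    by apply: out0; rewrite /window; clear -cN iN; lia.
  have -> : (\sum_(N - c + N <= i < 2 * N + 1) `|g.2 (i%:Z - N%:Z)%R|%N = 0)%N.
    rewrite big_nat_cond big1// => i /andP[iN _].
    by apply: out0; rewrite /window; clear -cN iN; lia.
  rewrite add0n addn0 -{1}[(N - c)%N]add0n big_addn addKn big_mkord.
  apply: leq_sum => i _; rewrite /v.
  by have -> : (i + (N - c))%N%:Z - N%:Z = i%:Z - c%:Z by clear -cN; lia.
apply: le_trans (profile_loss chiP vT).
rewrite (bigA_distr_big_dep (fun i (x : 'I_N) => (0 <= x%:Z + v i < N%:Z)%R)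
  (fun i (x : 'I_N) => chi x%:Z `^ p))/=.
rewrite big_mkcond [leRHS]big_mkcond/=; apply: ler_sum => u _.
have prod0 : 0 <= \prod_i chi (u i)%:Z `^ p by apply: prodr_ge0 => i _; exact: powR_ge0.
case: ifPn => [ukept|_]; last by case: ifP.
rewrite ifT//; apply/familyP => i; rewrite /in_mem/=.
have [_ _ /(_ _ (ltn_ord i))] := box_bump_neq0 ukept.
rewrite ZwrZ_mul_lampE config_site/= subr0 /v.
by have -> : M + i%:Z - (M + c%:Z - 0%:Z) = i%:Z - c%:Z by clear; lia.
Qed.

(** A configuration that leaves the box has [Phi] equal to 0 after translation, so it contributes
    its whole mass to the variation; by [kept_mass] these configurations carry a fixed
    proportion. *)
Lemma escape_variation (Phi : ZwrZ -> R) (a : R) : 0 <= a ->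
  (forall cw, Phi (@config 0 N cw) = a * box_bump (@config 0 N cw)) ->
  (forall cw, box_bump (@config 0 N cw) != 0 -> Phi (@config 0 N cw * g)%g != 0 ->
    box_bump (@config 0 N cw * g)%g != 0) ->
  ((a `^ p * (1 - expR (- (2 `^ (1 - p) / 8))))%:E <=
    \int[mu]_(x in setT) (`|Phi (x^-1 * g)%g - Phi x^-1%g| `^ p)%:E)%E.
Proof.
move=> a0 PhiE Phi_sep.
have p0 : p != 0 by rewrite gt_eqF// (lt_le_trans ltr01).
have inj : injective (fun cw => (@config 0 N cw)^-1%g : discrete_group ZwrZ).
  by move=> x y /invg_inj; exact: config_inj.
apply: le_trans (counting_integral_ge _ inj) => [|y]; last exact: powR_ge0.
rewrite lee_fin.
pose lost (c : 'I_N) (w : {ffun 'I_N -> 'I_N}) : R :=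
  if box_bump (config 0 (c, w) * g)%g != 0 then 0 else \prod_i chi (w i)%:Z `^ p.
have lower : a `^ p * (1 - expR (- (2 `^ (1 - p) / 8))) <=
    \sum_(c < N) \sum_(w : {ffun 'I_N -> 'I_N}) a `^ p * (chi c%:Z `^ p * lost c w).
  under eq_bigr do rewrite -!mulr_sumr.
  rewrite -mulr_sumr ler_wpM2l ?powR_ge0//.
  set e := expR _; have -> : 1 - e = \sum_(c < N) chi c%:Z `^ p * (1 - e).
    by rewrite -mulr_suml (profile_mass chiP) mul1r.
  apply: ler_sum => c _; rewrite ler_wpM2l ?powR_ge0// lerBlDr.
  apply: (@le_trans _ _ (\sum_(w : {ffun 'I_N -> 'I_N}) lost c w +
     \sum_(w | box_bump (@config 0 N (c, w) * g)%g != 0) \prod_i chi (w i)%:Z `^ p)).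
    rewrite [X in _ + X]big_mkcond -big_split/=.
    rewrite (eq_bigr (fun w : {ffun 'I_N -> 'I_N} => \prod_i chi (w i)%:Z `^ p)); last first.
      by move=> w _; rewrite /lost; case: ifP; rewrite ?addr0 ?add0r.
    rewrite -(bigA_distr_bigA (fun (i : 'I_N) (x : 'I_N) => chi x%:Z `^ p)).
    by rewrite big1// => i _; exact: profile_mass chiP.
  by rewrite lerD2l kept_mass.
apply: le_trans lower _.
rewrite pair_bigA/=; apply: ler_sum => -[c w] _ /=; rewrite invgK PhiE /lost.
case: ifPn => [_|]; first by rewrite !mulr0 powR_ge0.
rewrite negbK => /eqP escaped.
have bE := box_bump_config 0 (c, w); rewrite /= !subr0 in bE.
have chi0 x : 0 <= chi x := profile_ge0 chiP x.
have prod0 : 0 <= \prod_i chi ((w i)%:Z - 0%:Z) by apply: prodr_ge0.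
have [b0|bn0] := eqVneq (box_bump (config 0 (c, w))) 0.
  have -> : a `^ p * (chi c%:Z `^ p * \prod_i chi (w i)%:Z `^ p) =
      (a * box_bump (config 0 (c, w))) `^ p.
    rewrite bE !powRM ?mulr_ge0// powR_prod//; congr (_ * (_ * _)).
    by apply: eq_bigr => i _; rewrite subr0.
  by rewrite b0 mulr0 powR0// powR_ge0.
have -> : Phi (config 0 (c, w) * g)%g = 0.
  by apply/eqP; apply: contraTT isT => /(Phi_sep _ bn0); rewrite escaped eqxx.
rewrite sub0r normrN ger0_norm; last exact: mulr_ge0 a0 (box_bump_ge0 _).
rewrite bE !powRM ?mulr_ge0// powR_prod// le_eqVlt; apply/orP; left; apply/eqP.
by congr (_ * (_ * _)); apply: eq_bigr => i _; rewrite subr0.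
Qed.

End escape.

End box_bump.

(** * The cocycle *)

Lemma ZwrZ_radius (g : ZwrZ) :
  exists B, (`|g.1| <= B)%N /\ forall x, g.2 x != 0 -> (`|x| <= B)%N.
Proof.
exists (`|g.1| + \sum_(x <- finsupp g.2) `|x|)%N; split=> [|x gx]; first exact: leq_addr.
by apply: leq_trans (leq_addl _ _); rewrite (big_rem x)/= ?leq_addr// mem_finsupp.
Qed.

Section assembly.
Context {R : realType} {p : R} (p1 : (1 <= p%:E)%E).
Variables (a : nat -> R) (N_ : nat -> nat) (chi_ : nat -> int -> R) (K : nat).
Hypotheses (a0 : forall k, 0 <= a k) (K8 : (8 < K)%N)
  (chiP : forall k, lamp_profile p (2 ^+ k) (N_ k) (chi_ k)).
Local Notation mu := (counting : {measure set (discrete_group ZwrZ) -> \bar R}).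

Let pge1 : 1 <= p. Proof. by rewrite -lee_fin. Qed.

Definition site k : int := (K * 2 ^ k)%N%:Z.
(** The k with K 2^k <= |c| < K 2^(k+1), and 0 when |c| < K. Reading it off the cursor replaces the
    infinite sum of bumps by a single term. *)
Definition level (c : int) : nat := trunc_log 2 (`|c| %/ K)%N.
Definition level_bump k : ZwrZ -> R := @box_bump R (N_ k) (chi_ k) (site k).
Definition bump_sum (y : ZwrZ) : R := a (level y.1) * level_bump (level y.1) y.

Lemma window_size k : (N_ k <= 8 * 2 ^ k)%N.
Proof. by rewrite -(ler_nat R) natrM natrX; exact: profile_size (chiP k). Qed.

Lemma levelE k c : (K * 2 ^ k <= c < K * 2 ^ k.+1)%N -> level c%:Z = k.
Proof.
move=> /andP[kc ck]; have K0 : (0 < K)%N by apply: leq_trans K8.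
apply: trunc_log_eq => //; rewrite absz_nat leq_divRL// ltn_divLR//.
by rewrite mulnC kc mulnC ck.
Qed.

(** Box k starts at K 2^k and has length at most 8 * 2^k < K 2^k, so it ends before level k + 1. *)
Lemma level_window k c : window (site k) (N_ k) c -> level c = k.
Proof.
move=> ck; have -> : c = `|c|%N%:Z by move: ck; rewrite /window /site; clear; lia.
apply: levelE; have := window_size k; move: ck; rewrite /window /site expnS.
have : (8 * 2 ^ k < K * 2 ^ k)%N by rewrite ltn_pmul2r// expn_gt0.
rewrite mulnCA; move: (2 ^ k)%N (K * _)%N (N_ k) => x y z; clear; lia.
Qed.

Lemma level_bump_neq0 k y : level_bump k y != 0 -> window (site k) (N_ k) y.1.
Proof. by move=> /(box_bump_neq0 pge1 (chiP k))[]. Qed.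

(** Lets the variation at each y be computed with one bump, whose level may depend on y. *)
Definition same_level (s : ZwrZ) := forall y, exists k,
  bump_sum y = a k * level_bump k y /\ bump_sum (y * s)%g = a k * level_bump k (y * s)%g.

Lemma same_level_lamp : same_level (lamp_add 1).
Proof. by move=> y; exists (level y.1); rewrite /bump_sum lamp_add_cursor. Qed.

(** If the bump at y is nonzero, the room left after the box keeps the moved cursor at the same
    level. If it is zero, the level of the moved element works, since a nonzero bump there would
    force the levels to agree. *)
Lemma same_level_cursor : same_level (cursor_move 1).
Proof.
move=> y; set z := (y * _)%g; have zE : z.1 = y.1 + 1 by rewrite /z cursor_moveE.
pose k := level y.1; pose k' := level z.1.
have vanish j x : j = level x.1 -> bump_sum x = 0 -> a j * level_bump j x = 0.
  by move=> ->.
have [y0|yn0] := eqVneq (level_bump k y) 0.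
  exists k'; split=> //; rewrite /bump_sum -/k y0 mulr0.
  have [->|] := eqVneq (level_bump k' y) 0; first by rewrite mulr0.
  move=> /[dup] /level_bump_neq0/level_window; rewrite -/k => <-.
  by rewrite y0 eqxx.
exists k; split=> //; suff k'k : level z.1 = k by rewrite /bump_sum k'k.
have := level_bump_neq0 yn0; rewrite zE => yk.
have -> : y.1 + 1 = `|(y.1 + 1)%R|%N%:Z by move: yk; rewrite /window /site; clear; lia.
apply: levelE; have := window_size k; move: yk; rewrite /window /site expnS.
have : (8 * 2 ^ k < K * 2 ^ k)%N by rewrite ltn_pmul2r// expn_gt0.
rewrite mulnCA; move: (2 ^ k)%N (K * _)%N (N_ k) (y.1) => x x' x'' x3; clear; lia.
Qed.

(** Pointwise the integrand is one term of the nonnegative series over all levels, which may be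
    integrated term by term. *)
Lemma bump_sum_variation (s : ZwrZ) (e : nat -> R) : same_level s ->
  (forall k, (\int[mu]_(x in setT) (`|level_bump k (x^-1 * s)%g - level_bump k x^-1%g| `^ p)%:E
    <= (e k)%:E)%E) ->
  (\sum_(k <oo) (a k `^ p * e k)%:E < +oo)%E ->
  (\int[mu]_(x in setT) (`|bump_sum (x^-1 * s)%g - bump_sum x^-1%g| `^ p)%:E < +oo)%E.
Proof.
move=> s_level es sum_lty.
pose F k (x : discrete_group ZwrZ) : \bar R :=
  (a k `^ p * `|level_bump k (x^-1 * s)%g - level_bump k x^-1%g| `^ p)%:E.
have F0 k x : (0 <= F k x)%E by rewrite lee_fin mulr_ge0 ?powR_ge0.
apply: le_lt_trans sum_lty.
apply: (@le_trans _ _ (\int[mu]_(x in setT) (\sum_(k <oo) F k x))%E).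
  apply: ge0_le_integral => //.
  - move=> x _; have [k [-> ->]] := s_level x^-1%g.
    rewrite -mulrBr normrM (ger0_norm (a0 k)) powRM//.
    apply: le_trans (@nneseries_lim_ge _ (F ^~ x) xpredT 0%N k.+1 _); last first.
      by move=> n _ _; exact: F0.
    rewrite big_nat_recr//= leeDr//.
    by apply: sume_ge0 => n _; exact: F0.
rewrite integral_nneseries//; apply: lee_nneseries => [k _ *|k _].
  by apply: integral_ge0 => x _; exact: F0.
rewrite /F; under eq_integral do rewrite EFinM.
rewrite ge0_integralZl//; last by rewrite lee_fin powR_ge0.
by rewrite EFinM lee_wpmul2l ?lee_fin ?powR_ge0.
Qed.

(** The formal coboundary of x |-> [bump_sum] (x^-1) for left translation; only this difference is
    shown to be p-summable. *)
Definition variation (g : ZwrZ) (x : discrete_group ZwrZ) : R :=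
  bump_sum (x^-1 * g)%g - bump_sum x^-1%g.

Hypothesis a_summable :
  (\sum_(k <oo) ((a k / (2 ^+ k) `^ (p / (2 * p - 1))) `^ p)%:E < +oo)%E.

Lemma variation_step (s : ZwrZ) : same_level s ->
  (forall k, (\int[mu]_(x in setT) (`|level_bump k (x^-1 * s)%g - level_bump k x^-1%g| `^ p)%:E
    <= (5 * ((2 ^+ k) `^ (p / (2 * p - 1))) `^ (- p))%:E)%E) ->
  variation s \in Lfun mu p%:E.
Proof.
move=> s_level es; apply: Lfun_counting; apply: bump_sum_variation s_level es _.
rewrite (eq_eseriesr (g := fun k =>
  (5%:E * ((a k / (2 ^+ k) `^ (p / (2 * p - 1))) `^ p)%:E)%E)); last first.
  move=> k _; rewrite -EFinM; congr (_%:E); rewrite mulrCA; congr (_ * _).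
  have T0 : 0 < (2 ^+ k) `^ (p / (2 * p - 1)) :> R by rewrite powR_gt0// exprn_gt0.
  by rewrite powRM// ?invr_ge0 ?ltW// inv_powR// powRN.
rewrite nneseriesZl//; last by move=> k _; rewrite lee_fin powR_ge0.
by rewrite lte_mul_pinfty// ?lee_fin.
Qed.

Lemma variation_mul g h : variation (g * h)%g =
  (fun x : discrete_group ZwrZ => variation h (g^-1 * x)%g) \+ variation g.
Proof.
by apply/funext => x; rewrite /variation/= invgM invgK -mulgA addrA subrK.
Qed.

Lemma translate_in_Lfun (g : ZwrZ) (f : discrete_group ZwrZ -> R) :
  f \in Lfun mu p%:E ->
  (fun x : discrete_group ZwrZ => f (g^-1 * x)%g) \in Lfun mu p%:E.
Proof. by move=> fL; have := translate_Lfun g (Lfun_Sub p1 fL). Qed.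

(** By the cocycle identity, p-summability passes to products and inverses, so the two generators
    suffice; [word_bound] with a cost that is ignored serves as the generation statement. *)
Lemma variation_Lfun g : variation g \in Lfun mu p%:E.
Proof.
have addL f h : f \in Lfun mu p%:E -> h \in Lfun mu p%:E -> f \+ h \in Lfun mu p%:E.
  exact: (Lfun_addr_closed mu p1).2.
have V1 : variation (cursor_move 1) \in Lfun mu p%:E.
  apply: variation_step same_level_cursor _ => k.
  exact: box_bump_cursor_variation pge1 (chiP k) _.
have V2 : variation (lamp_add 1) \in Lfun mu p%:E.
  apply: variation_step same_level_lamp _ => k.
  exact: box_bump_lamp_variation pge1 (chiP k) _.
have VM g' h : variation g' \in Lfun mu p%:E -> variation h \in Lfun mu p%:E ->
    variation (g' * h)%g \in Lfun mu p%:E.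
  by move=> gL hL; rewrite variation_mul addL// translate_in_Lfun.
have VV h : variation h \in Lfun mu p%:E -> variation h^-1%g \in Lfun mu p%:E.
  move=> hL; have -> : variation h^-1%g =
      \- (fun x : discrete_group ZwrZ => variation h (h^-1^-1 * x)%g).
    apply/funext => x; rewrite /variation /= !invgK invgM -mulgA mulVg mulg1.
    by rewrite opprB.
  by rewrite (rpredN (Lfun mu p%:E)); exact: translate_in_Lfun.
have [B [gB1 gB2]] := ZwrZ_radius g.
have abs1 (e : int) : `|e|%N = 1%N -> e = 1 \/ e = -1 by lia.
have [||||n _ //] := @word_bound (fun _ h => variation h \in Lfun mu p%:E) 0 _ _ _ _ g B gB1 gB2.
- rewrite -(mulVg (cursor_move 1)); apply: VM => //; exact: VV.
- by move=> _ _ x y; exact: VM.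
- move=> e /abs1[->//|->]; have -> : cursor_move (-1) = (cursor_move 1)^-1%g.
    by apply: (mulgI (cursor_move 1)); rewrite -cursor_moveD mulgV subrr.
  exact: VV.
- move=> e /abs1[->//|->]; have -> : lamp_add (-1) = (lamp_add 1)^-1%g.
    apply: (mulgI (lamp_add 1)); rewrite -lamp_addD mulgV subrr.
    by apply: ZwrZ_eqP => // x; rewrite lamp_windowE lamps0; case: ifP.
  exact: VV.
Qed.

Local Open Scope quotient_scope.

Definition bump_cocycle (g : ZwrZ) : ellp ZwrZ p1 :=
  \pi_(Lp mu p1) (Lfun_Sub p1 (variation_Lfun g)).

Lemma bump_cocycleP : cocycle (lreg ZwrZ p1) bump_cocycle.
Proof.
move=> g h; rewrite /bump_cocycle /= lreg_fun_pi -Lp_piD.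
by apply/Lp_piP/ae_counting => x _; rewrite /= variation_mul.
Qed.

(** The gap between boxes exceeds D times the larger power of two that is involved, so a
    displacement by D 2^k cannot bridge it. *)
Lemma level_displaced (k j D : nat) (c m : int) : (2 * D + 8 < K)%N ->
  (`|m| <= D * 2 ^ k)%N -> window (site k) (N_ k) c -> window (site j) (N_ j) (c + m) ->
  j = k.
Proof.
move=> DK mD ck cj; have Nk := window_size k; have Nj := window_size j.
(* For Y the smaller and X the larger power of two: the end of the lower box plus D X stays below
   the start of the upper one. *)
have lower (X Y : nat) : (2 * Y <= X -> (K + 8) * Y + D * X < K * X \/ X = 0)%N.
  case: X => [|X]; [by right|left]; nia.
have [kj|jk|//] := ltngtP k j.
  have jk2 : (2 * 2 ^ k <= 2 ^ j)%N by rewrite -expnS leq_exp2l.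
  move: ck cj mD Nk Nj; rewrite /window /site.
  have [|/eqP] := lower _ _ jk2; last by rewrite -leqn0 leqNgt expn_gt0.
  have := leq_mul (leqnn D) (leq_trans (leq_pmull (2 ^ k) (isT : (0 < 2)%N)) jk2).
  rewrite mulnDl.
  move: (2 ^ k)%N (2 ^ j)%N => X Y.
  move: (K * X)%N (K * Y)%N (D * X)%N (D * Y)%N => *; lia.
have kj2 : (2 * 2 ^ j <= 2 ^ k)%N by rewrite -expnS leq_exp2l.
move: ck cj mD Nk Nj; rewrite /window /site.
have [|/eqP] := lower _ _ kj2; last by rewrite -leqn0 leqNgt expn_gt0.
rewrite mulnDl; move: (2 ^ k)%N (2 ^ j)%N => X Y.
move: (K * X)%N (K * Y)%N (D * X)%N => *; lia.
Qed.

Lemma bump_cocycle_ge (g : ZwrZ) (k D : nat) :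
  (2 * D + 8 < K)%N -> (`|g.1| <= D * 2 ^ k)%N ->
  ((`|g.1| < N_ k)%N -> (forall x, g.2 x != 0 -> (`|x| < N_ k)%N) ->
    33 * 2 ^+ k <= (\sum_(i < 2 * N_ k + 1) `|g.2 (i%:Z - (N_ k)%:Z)%R|)%N%:R :> R) ->
  a k * (1 - expR (- (2 `^ (1 - p) / 8))) `^ p^-1 <= `|bump_cocycle g|.
Proof.
move=> DK gD g_long.
have p0 : 0 < p := lt_le_trans ltr01 pge1.
have pV a' : 0 <= a' -> (a' `^ p) `^ p^-1 = a' :> R.
  by move=> a'0; rewrite -powRrM divff ?gt_eqF// powRr1.
set c := 1 - _; have c0 : 0 <= c.
  by rewrite subr_ge0 -[leRHS]expR0 ler_expR oppr_le0 divr_ge0// powR_ge0.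
suff : a k `^ p * c <= `|bump_cocycle g| `^ p.
  move=> h; rewrite -[a k]pV// -[leRHS]pV// -powRM ?powR_ge0//.
  by apply: ge0_ler_powR; rewrite ?nnegrE ?invr_ge0 ?mulr_ge0 ?powR_ge0// ltW.
rewrite -lee_fin ellp_norm_powR.
apply: (escape_variation pge1 (chiP k) g_long (M := site k) (a0 k)) => cw.
  rewrite /bump_sum (@level_window k)//= /window; have := ltn_ord cw.1.
  by clear; lia.
move=> /level_bump_neq0 yk; rewrite /bump_sum mulf_eq0 negb_or => /andP[_ yg].
have := level_bump_neq0 yg; rewrite {3}ZwrZ_mulE/= => ygj.
by move: yg; rewrite (level_displaced DK gD yk ygj).
Qed.

End assembly.

(** * Compression at dyadic scales and the integral condition *)

Lemma minimal_word (S : set ZwrZ) (Ssym : symmetric_set S) (Sgen : generating S) g :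
  exists2 n, set_exp S n g & forall m, set_exp S m g -> (n <= m)%N.
Proof.
have [n0 Sn0] := set_exp_total Ssym Sgen g.
have ex : exists n, `[< set_exp S n g >] by exists n0; apply/asboolP.
case: (ex_minnP ex) => n /asboolP Sn n_min; exists n => // m Sm.
by apply: n_min; apply/asboolP.
Qed.

Section main_estimate.
Context {R : realType} {p : R} (p1 : (1 <= p%:E)%E).
Variables (S : set ZwrZ) (Sfin : finite_set S) (Ssym : symmetric_set S)
  (Sgen : generating S).
Local Notation q := (p / (2 * p - 1)).

Let pge1 : 1 <= p. Proof. by rewrite -lee_fin. Qed.

Lemma cocycle_of_dyadic (f : R -> R) :
  (forall t, 0 <= t -> 0 <= f t) ->
  (forall s t, 0 <= s -> s <= t -> f s <= f t) ->
  (\sum_(k <oo) ((f (2 ^+ k) / (2 ^+ k) `^ q) `^ p)%:E < +oo)%E ->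
  exists2 b : ZwrZ -> ellp ZwrZ p1,
    cocycle (lreg ZwrZ p1) b & asymp_le (fun t => (f t)%:E) (compression S b).
Proof.
move=> f0 f_incr f_sum.
have [C1 C1_gt0 wordC1] := set_exp_bound Ssym Sgen.
have [C2 cursorC2] := cursor_bound Sfin.
(* If |g| >= K0 2^k, then 75 * 2^k <= 5N + 2 + s with s the lamp sum and N <= 8 * 2^k, so s >= 33 *
   2^k. [D] bounds the cursor for |g| < K0 2^(k+1), and [K] is the least value with 2D + 8 < K. *)
pose K0 := (75 * C1)%N; pose D := (2 * K0 * C2)%N; pose K := (2 * D + 9)%N.
have [NC NCP] : {NC : nat -> nat * (int -> R) &
    forall k, lamp_profile p (2 ^+ k) (NC k).1 (NC k).2}.
  apply: (@choice _ _ (fun k NC => lamp_profile p (2 ^+ k) NC.1 NC.2)) => k.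
  have T1 : 1 <= 2 ^+ k :> R by apply: exprn_ege1; rewrite ler1n.
  by have [N [chi chiP]] := lamp_profile_exists pge1 T1; exists (N, chi).
pose a k := f (2 ^+ k).
have a0 k : 0 <= a k by apply: f0; exact: exprn_ge0.
have K8 : (8 < K)%N by rewrite /K; clear; lia.
pose b := bump_cocycle p1 a0 K8 NCP f_sum.
exists b; first exact: bump_cocycleP.
set e : R := expR (- (2 `^ (1 - p) / 8)).
have c_gt0 : 0 < 1 - e.
  by rewrite subr_gt0 -[ltRHS]expR0 ltr_expR oppr_lt0 divr_gt0// powR_gt0.
have K0_gt0 : (0 < K0)%N by rewrite muln_gt0.
exists (2 * K0)%:R; first by rewrite ltr0n muln_gt0.
exists ((1 - e) `^ p^-1)^-1; first by rewrite invr_gt0 powR_gt0.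
near=> t; rewrite -lee_pdivrMl ?invr_gt0 ?powR_gt0// invrK -EFinM.
apply: le_ereal_inf_tmp => _ [g /= tg <-]; rewrite lee_fin.
have t1 : 1 <= t by near: t; exact: nbhs_pinfty_ge.
have [n Sn n_min] := minimal_word Ssym Sgen g.
have tn : (2 * K0)%:R * t <= n%:R.
  by rewrite -lee_fin; apply: le_trans tg _; apply: ereal_inf_lbound; exists n.
have K0n : (K0 <= n)%N.
  rewrite -(ler_nat R); apply: le_trans tn.
  by rewrite natrM [2 * _]mulrC -mulrA ler_peMr//; lra.
(* The dyadic scale of g: 2 K0 t <= n < 2 K0 2^k gives t <= 2^k, so the monotone f is at most the
   weight of level k. *)
pose k := trunc_log 2 (n %/ K0).
have /andP[kn nk] : (K0 * 2 ^ k <= n < K0 * 2 ^ k.+1)%N.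
  rewrite mulnC -leq_divRL// [(K0 * _)%N]mulnC -ltn_divLR//.
  by apply: trunc_log_bounds; rewrite ?divn_gt0.
have tk : t <= 2 ^+ k.
  have : (2 * K0)%:R * t <= (2 * K0)%:R * 2 ^+ k.
    apply: le_trans tn _; rewrite -natrX -natrM ler_nat.
    by apply: ltnW; move: nk; rewrite expnS; clear; lia.
  by rewrite ler_pM2l// ltr0n muln_gt0.
have fta : f t <= a k by apply: f_incr => //; exact: le_trans t1.
rewrite mulrC; apply: le_trans (@bump_cocycle_ge _ _ p1 a _ _ K a0 K8 NCP f_sum g k D _ _ _).
- by rewrite ler_wpM2r// powR_ge0.
- by rewrite /K; clear; lia.
- apply: leq_trans (cursorC2 _ _ Sn) _; rewrite /D mulnAC mulnC leq_mul2r.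
  by apply/orP; right; move: nk; rewrite expnS; clear; lia.
- move=> g1N g2N; rewrite -natrX -natrM ler_nat.
  have NT : ((NC k).1 <= 8 * 2 ^ k)%N.
    by rewrite -(ler_nat R) natrM natrX; exact: profile_size (NCP k).
  have [||m mC Sm] := wordC1 g (NC k).1; first exact: ltnW.
    by move=> x /g2N/ltnW.
  have := leq_trans kn (leq_trans (n_min _ Sm) mC).
  rewrite /K0 [(75 * C1)%N]mulnC -mulnA leq_pmul2l// => le75.
  have := expn_gt0 2 k; move: le75 NT; set s := (\sum_(i < _) _)%N.
  by move: s (2 ^ k)%N (NC k).1; clear; lia.
Unshelve. all: by end_near.
Qed.

Let q_gt0 : 0 < q.
Proof. by have := pge1 => p1'; apply: divr_gt0; lra. Qed.

Let p_gt0 : 0 < p. Proof. exact: lt_le_trans ltr01 pge1. Qed.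

(** Since f increases, the integral over [2^k, 2^(k+1)) dominates a fixed multiple of the k-th term
    of the series. *)
Lemma dyadic_of_integral (f : R -> R) :
  (forall t, 0 <= t -> 0 <= f t) ->
  (forall s t, 0 <= s -> s <= t -> f s <= f t) ->
  (\int[lebesgue_measure]_(t in `[1%R, +oo[) ((f t / t `^ q) `^ p / t)%:E < +oo)%E ->
  (\sum_(k <oo) ((f (2 ^+ k) / (2 ^+ k) `^ q) `^ p)%:E < +oo)%E.
Proof.
move=> f0 f_incr f_int.
pose F (t : R) : \bar R := ((f t / t `^ q) `^ p / t)%:E.
pose J : set R := `[1%R, +oo[%classic.
pose I k : set R := `[2 ^+ k, 2 ^+ k.+1[%classic.
have pow2 k : 0 < 2 ^+ k :> R by exact: exprn_gt0.
have I1 k t : I k t -> 1 <= t.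
  rewrite /I/= in_itv/= => /andP[kt _]; apply: le_trans kt.
  by apply: exprn_ege1; rewrite ler1n.
have F0 t : 1 <= t -> (0 <= F t)%E.
  by move=> t1; rewrite lee_fin divr_ge0 ?powR_ge0// (le_trans ler01).
have mJ : measurable J by exact: measurable_itv.
have mI k : measurable (I k) by exact: measurable_itv.
have mF : measurable_fun J F.
  apply/measurable_EFinP.
  have mpow (r : R) : measurable_fun J (fun t : R => t `^ r).
    by apply: measurable_funTS; exact: measurable_powR.
  (* f is monotone on the half-line only; composing with max(0, t) makes it monotone on all of R,
     hence measurable. *)
  have mh : measurable_fun J
      (fun t : R => (f (Num.max 0 t) * t `^ (- q)) `^ p * t `^ (- 1)).
    apply: measurable_funM; last exact: mpow.
    apply: (measurableT_comp (measurable_powR p)).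
    apply: measurable_funM; last exact: mpow.
    apply: nondecreasing_measurable => // x y xy; apply: f_incr.
      by rewrite le_max lexx.
    by rewrite ge_max !le_max lexx xy orbT.
  apply: eq_measurable_fun mh => t.
  rewrite inE /J/= in_itv/= andbT => t1.
  have t0 : 0 <= t by rewrite (le_trans ler01).
  by rewrite max_r// powRN powR_inv1.
have trivI : trivIset setT I.
  apply/trivIsetP => i j _ _ ij; apply/seteqP; split => // t [].
  rewrite /I/= !in_itv/= => /andP[it ti] /andP[jt tj].
  have h (m n : nat) : (m < n)%N -> 2 ^+ n <= t -> t < 2 ^+ m.+1 -> False.
    move=> mn nt tm; have : (2 : R) ^+ m.+1 <= 2 ^+ n by rewrite ler_weXn2l// ler1n.
    by move: (le_lt_trans nt tm) => /[swap]; rewrite leNgt => /negP.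
  by move: ij; rewrite neq_ltn => /orP[ij|ij]; [exact: h ij jt ti|exact: h ij it tj].
(* Replacing t by 2^(k+1) in the two denominators costs 2^(-qp) and, with the length 2^k of the
   interval, 1/2. *)
pose c : R := (2 `^ q)^-1 `^ p / 2.
have c0 : 0 < c by rewrite divr_gt0// powR_gt0// invr_gt0 powR_gt0.
have step k : ((c * (f (2 ^+ k) / (2 ^+ k) `^ q) `^ p)%:E <=
    \int[lebesgue_measure]_(t in I k) F t)%E.
  pose m : R := (f (2 ^+ k) / (2 ^+ k.+1) `^ q) `^ p / 2 ^+ k.+1.
  have m_le (t : R) : 2 ^+ k <= t -> t < 2 ^+ k.+1 -> m <= (f t / t `^ q) `^ p / t.
    move=> kt tk; have t0 : 0 < t := lt_le_trans (pow2 k) kt.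
    have fk0 : 0 <= f (2 ^+ k) by apply: f0; exact: ltW.
    have ft0 : 0 <= f t by apply: f0; exact: ltW.
    apply: ler_pM; [exact: powR_ge0|by rewrite invr_ge0 ltW| |].
      apply: ge0_ler_powR.
      - exact: ltW.
      - by rewrite nnegrE divr_ge0 ?powR_ge0.
      - by rewrite nnegrE divr_ge0 ?powR_ge0.
      apply: ler_pM; [exact: fk0|by rewrite invr_ge0 powR_ge0| |].
        by apply: f_incr kt; exact: ltW.
      rewrite lef_pV2 ?posrE ?powR_gt0//.
      by apply: ge0_ler_powR; rewrite ?nnegrE; exact: ltW.
    by rewrite lef_pV2 ?posrE// ltW.
  have -> : (c * (f (2 ^+ k) / (2 ^+ k) `^ q) `^ p)%:E =
      (\int[lebesgue_measure]_(t in I k) (cst m%:E) t)%E.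
    have muI : (lebesgue_measure (I k) = (2 ^+ k)%:E)%E.
      rewrite lebesgue_measure_itv/= lte_fin ifT; last by rewrite exprS ltr_pMl// ltr1n.
      by rewrite -EFinB exprS; congr (_%:E); ring.
    rewrite integral_cst; last exact: mI.
    rewrite [RHS](_ : _ = (m%:E * (2 ^+ k)%:E)%E); last by rewrite -muI.
    rewrite -EFinM; congr (_%:E); rewrite /m /c.
    have -> : f (2 ^+ k) / (2 ^+ k.+1) `^ q =
        (2 `^ q)^-1 * (f (2 ^+ k) / (2 ^+ k) `^ q).
      by rewrite exprS powRM ?(ltW (pow2 k))// invfM mulrCA.
    have : 0 <= f (2 ^+ k) / (2 ^+ k) `^ q by rewrite divr_ge0 ?powR_ge0// f0// ltW.
    move: (f _ / _) => Y Y0; rewrite powRM ?invr_ge0 ?powR_ge0// exprS.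
    move: (_ `^ p) (Y `^ p) (gt_eqF (pow2 k)) => U V; move: (2 ^+ k) => X X0.
    by field; rewrite X0.
  apply: ge0_le_integral; first exact: mI.
  - by move=> t _; rewrite lee_fin divr_ge0 ?powR_ge0// ltW.
  - exact: measurable_cst.
  - apply: measurable_funS mF => // t /I1 t1.
    by rewrite /J/= in_itv/= t1.
  - by move=> t; rewrite /I/= in_itv/= => /andP[kt tk]; rewrite lee_fin; exact: m_le.
have sum_le : (\sum_(k <oo) (c%:E * ((f (2 ^+ k) / (2 ^+ k) `^ q) `^ p)%:E) < +oo)%E.
  apply: le_lt_trans f_int.
  apply: (@le_trans _ _ (\sum_(k <oo) \int[lebesgue_measure]_(t in I k) F t)%E).
    apply: lee_nneseries => [k _ *|k _]; last by rewrite -EFinM.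
    by rewrite lee_fin mulr_ge0 ?powR_ge0// ltW.
  have subI : \bigcup_k I k `<=` J.
    by move=> t [k _ /I1 t1]; rewrite /J/= in_itv/= t1.
  rewrite -ge0_integral_bigcup; [|exact: mI| | |exact: trivI]; last 2 first.
  - by apply: measurable_funS mF.
  - by move=> t [k _ /I1]; exact: F0.
  apply: ge0_subset_integral => //.
    by apply: bigcup_measurable => k _; exact: mI.
  by move=> t; rewrite /J/= in_itv/= andbT; exact: F0.
move: sum_le; rewrite nneseriesZl//.
  set s := (\sum_(k <oo) _)%E; have s0 : (0 <= s)%E.
    by apply: nneseries_ge0 => k _ _; rewrite lee_fin powR_ge0.
  by case: s s0 => [s| |]//=; rewrite ?ltry// mulry gtr0_sg// mul1e.
by move=> k _; rewrite lee_fin powR_ge0.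
Qed.

(** A geometric series of ratio 2^(-(q - alpha) p) < 1. *)
Lemma dyadic_powR (alpha : R) : alpha < q ->
  (\sum_(k <oo) (((2 ^+ k) `^ alpha / (2 ^+ k) `^ q) `^ p)%:E < +oo)%E.
Proof.
move=> aq; pose z : R := 2^-1 `^ ((q - alpha) * p).
have z0 : 0 < z by apply: powR_gt0; rewrite invr_gt0.
have z1 : z < 1.
  have -> : 1 = 1 `^ ((q - alpha) * p) :> R by rewrite powR1.
  apply: gt0_ltr_powR; rewrite ?nnegrE ?invr_ge0 ?invf_lt1 ?ltr1n//.
  by rewrite mulr_gt0// subr_gt0.
have termE k : (((2 ^+ k) `^ alpha / (2 ^+ k) `^ q) `^ p)%:E = (z ^+ k)%:E.
  have T0 : 0 < 2 ^+ k :> R by exact: exprn_gt0.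
  congr (_%:E); rewrite -powRN -powRD_gt0// -powRrM -[2 ^+ k]powR_mulrn//.
  rewrite -powRrM mulrC -[z ^+ k]powR_mulrn ?ltW// /z -powRrM inv_powR// -powRN.
  by congr (_ `^ _); ring.
rewrite (eq_eseriesr (fun k _ => termE k)).
apply: (@le_lt_trans _ _ ((1 - z)^-1)%:E); last exact: ltry.
apply: lime_le.
  by apply: is_cvg_nneseries => n _ _; rewrite lee_fin exprn_ge0// ltW.
apply: nearW => n; rewrite sumEFin lee_fin big_mkord.
have z1' : 0 < 1 - z by rewrite subr_gt0.
rewrite -(ler_pM2l z1') mulfV ?gt_eqF//.
have -> : (1 - z) * \sum_(i < n) z ^+ i = 1 - z ^+ n.
  by rewrite -[1 - z]opprB mulNr -subrX1 opprB.
by rewrite gerBl exprn_ge0// ltW.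
Qed.

End main_estimate.

Unset Implicit Arguments.

Theorem theorem17 (R : realType) (p : R) (p1 : (1 <= p%:E)%E)
  (S : set ZwrZ) (Sfin : finite_set S) (Ssym : symmetric_set S)
  (Sgen : generating S) :
  (forall f : R -> R,
    (forall t, 0 <= t -> 0 <= f t) ->
    (forall s t, 0 <= s -> s <= t -> f s <= f t) ->
    (\int[lebesgue_measure]_(t in `[1%R, +oo[)
       ((f t / t `^ (p / (2 * p - 1))) `^ p / t)%:E < +oo)%E ->
    exists2 b : ZwrZ -> ellp ZwrZ p1,
      cocycle (lreg ZwrZ p1) b &
      asymp_le (fun t => (f t)%:E) (compression S b)) /\
  ((p / (2 * p - 1))%:E <= B_Lp S p1)%E.
Proof.
split=> [f f0 f_incr f_int|].
  by apply: cocycle_of_dyadic => //; exact: dyadic_of_integral.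
set q := p / (2 * p - 1).
have q0 : 0 < q.
  have : 1 <= p by rewrite -lee_fin.
  by move=> p1'; apply: divr_gt0; lra.
(* Exponents below q suffice for the supremum; the maximum with 0 respects the sign condition in
   [B_repr]. *)
apply/lee_subgt0Pr => e e0; pose alpha := Num.max 0 (q - e).
have alpha0 : 0 <= alpha by rewrite le_max lexx.
have alpha_q : alpha < q by rewrite gt_max q0 gtrBl.
apply: (@le_trans _ _ alpha%:E).
  by rewrite -EFinB lee_fin le_max lexx orbT.
have [b bP b_ge] := cocycle_of_dyadic p1 Sfin Ssym Sgen
  (fun t _ => powR_ge0 t alpha)
  (fun s t s0 st => ge0_ler_powR alpha0 s0 (le_trans s0 st) st)
  (dyadic_powR p1 alpha_q).
apply: (@le_trans _ _ (B_repr S (lreg ZwrZ p1))).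
  by apply: ereal_sup_ubound; exists alpha => //; split=> //; exists b.
apply: ereal_sup_ubound => /=.
by exists default_measure_display, (discrete_group ZwrZ), counting, (lreg ZwrZ p1).
Qed.
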